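(* Let $\rho\in\mathbb{C}$ with $\Re(\rho)>0$ and let $n\geq 0$ be an integer. For all $s\in\mathbb{C}$, $$e^{\frac{-s^2+s}{16\rho}}\,\mathcal{M}\big[e^{-\rho\ln^2(\cdot)}\Delta_4^{n+1}\Psi\big]\left(\frac{s}{2}\right)=e^{\frac{1}{64\rho}}\,\mathcal{M}\big[e^{-\rho\ln^2(\cdot)}\Delta_4^{n+1}\Psi\big]\left(\frac14\right)\cosh\left(\frac{\frac12-s}{16\rho}\right)+\frac{1}{16\rho}\int_{1/2}^{s}\sinh\left(\frac{s-t}{16\rho}\right)e^{\frac{-t^2+t}{16\rho}}\,\mathcal{M}\big[e^{-\rho\ln^2(\cdot)}\Delta_4^{n+2}\Psi\big]\left(\frac{t}{2}\right)dt .$$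
   Context: For $t>0$, $\Psi(t)=\sum_{n=1}^\infty e^{-\pi n^2 t}$. The Mellin transform is $\mathcal{M}[f](s)=\int_0^\infty t^{s}f(t)\,\frac{dt}{t}$. The operator $\Delta_4$ acts on smooth functions on $(0,\infty)$ by $(\Delta_4\psi)(t)=8\left(2t^2\psi''(t)+3t\psi'(t)\right)$, and $\Delta_4^k$ is its $k$-fold iterate. The integral from $1/2$ to $s$ is a contour integral of an entire function along any path in $\mathbb{C}$. *)

(* Defs.v *)
From Stdlib Require Import Reals.
From Coquelicot Require Import Coquelicot.
Open Scope R_scope.

Definition Cexp (z : C) : C := (exp (Re z) * cos (Im z), exp (Re z) * sin (Im z)).

Definition Ccosh (z : C) : C := ((Cexp z + Cexp (- z)) / 2)%C.

Definition Csinh (z : C) : C := ((Cexp z - Cexp (- z)) / 2)%C.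

(* The sum over n >= 1; [Series] starts at 0. *)
Definition Psi (t : R) : R := Series (fun n => exp (- PI * INR (S n) ^ 2 * t)).

(* [Derive] and [Derive_n] are local, so on (0, +oo) this depends only on the
   restriction of [psi] to (0, +oo). *)
Definition Delta4 (psi : R -> R) (t : R) : R :=
  8 * (2 * t ^ 2 * Derive_n psi 2 t + 3 * t * Derive psi t).

(* [C] is seen as a normed space over [R], for integrals along the real line. *)
Definition Mellin (f : R -> C) (s : C) : C :=
  @RInt_gen C_R_CompleteNormedModule
    (fun t => Cexp (s * ln t) * f t / t)%C (at_right 0) (Rbar_locally p_infty).

Definition log_gauss (rho : C) (f : R -> R) (t : R) : C :=
  (Cexp (- rho * (ln t ^ 2)%R) * f t)%C.

(* The continuous function [dg] on a closed subinterval gives the one-sided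
   limits of the derivative at the breakpoints [u i]. *)
Definition piecewise_C1_path (g : R -> C) (z w : C) : Prop :=
  g 0 = z /\ g 1 = w /\
  continuous_on (fun t => 0 <= t <= 1) g /\
  exists (m : nat) (u : nat -> R),
    u 0%nat = 0 /\ u m = 1 /\
    forall i, (i < m)%nat ->
      u i < u (S i) /\
      exists dg : R -> C,
        continuous_on (fun t => u i <= t <= u (S i)) dg /\
        forall t, u i < t < u (S i) ->
          @is_derive R_AbsRing C_R_NormedModule g t (dg t).

(* The derivative of [g] is taken componentwise; its values at the finitely many
   breakpoints do not affect the integral. *)
Definition path_integral (f : C -> C) (g : R -> C) : C :=
  @RInt C_R_CompleteNormedModule
    (fun u => f (g u) * (Derive (fun v => Re (g v)) u, Derive (fun v => Im (g v)) u))%C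
    0 1.

(* Main.v *)
Require Import Defs.
From Stdlib Require Import Reals Lra Lia ZArith.
From Coquelicot Require Import Coquelicot.
Open Scope R_scope.

(** In the variable x = ln t the operator Delta4 becomes 16 D^2 + 8 D.  Writing a
    function as psi (exp x) = exp (- x / 4) * h x turns it into 16 D^2 - 1 acting
    on h, and it kills the constants ([Delta4_represents]).  For Psi + 1/2 the
    function h is even: this is the functional equation of the theta function
    ([theta_functional_equation]).  Hence every iterate of Delta4 on Psi is
    represented by an even smooth h with derivatives of at most exponential growth
    ([iter_Delta4_represents], [theta_even_tower]).

    With k = 1 / (16 rho) and w = s - 1/2, completing the square in
    exp (w x / 2 - rho x^2) shows that exp (k (s - s^2)) times the Mellin transform
    at s / 2 is exp (1 / (64 rho)) times the Gaussian convolution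
      J_h (c) = int exp (- rho (x - c)^2) h x dx   at   c = 4 k w
    ([Mellin_represents]).  The function J_h is entire and J_h' = J_(h')
    ([gauss_convolution_is_Cderive]).  So H (s) = J_h (4 k (s - 1/2)) satisfies
    H'' = k^2 (H + Q), where Q is the same function built from 16 h'' - h, that is,
    from one more application of Delta4.  Since h' is odd, H' (1/2) = 0
    ([gauss_convolution_odd]).  The claimed identity is the formula of variation of
    constants for this equation ([variation_of_constants]): the integrand has the
    primitive
      (1 / k^2) (sinh (k (s - t)) H' (t) + k cosh (k (s - t)) H (t)),
    whose increment between the endpoints is the integral along any piecewise C1 path
    ([path_integral_primitive]).

    The functional equation is obtained from a random walk on the integers with
    steps -1, 0, 1 of probabilities 1/4, 1/2, 1/4.  The probability of being in
    l Z at time m is the sum of the point masses at the multiples of l, and by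
    Fourier analysis on Z / l it is also the mean of cos^(2m) over the angles
    pi v / l ([finite_theta]).  For l^2 / m tending to a both sides become theta
    series by dominated convergence ([cos_sum_lim], [walk_ratio_sum_lim]).  This
    expresses the limit of sqrt m times the return probability through theta for
    every a ([return_prob_lim]), and comparison with a = pi gives the equation. *)

(** * A random walk on the integers *)

Lemma exp_le_compat x y : x <= y -> exp x <= exp y.
Proof. intros [H|<-]; [left; now apply exp_increasing|right; reflexivity]. Qed.

(** The expectation of [phi] at time [m] for the walk started at [k]. *)
Fixpoint walk (m : nat) (phi : Z -> R) (k : Z) : R :=
  match m with
  | O => phi k
  | S m => (walk m phi (k - 1) + 2 * walk m phi k + walk m phi (k + 1)) / 4
  end.

Lemma walk_ext m phi psi k :
  (forall j, (Z.abs (j - k) <= Z.of_nat m)%Z -> phi j = psi j) ->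
  walk m phi k = walk m psi k.
Proof.
  revert k; induction m as [|m IH]; intros k H; simpl.
  - apply H; lia.
  - rewrite (IH (k - 1)%Z), (IH k), (IH (k + 1)%Z); try reflexivity;
      intros j Hj; apply H; lia.
Qed.

Lemma walk_plus m phi psi k :
  walk m (fun j => phi j + psi j) k = walk m phi k + walk m psi k.
Proof.
  revert k; induction m as [|m IH]; intros k; simpl; [|rewrite !IH]; lra.
Qed.

Lemma walk_scal m c phi k :
  walk m (fun j => c * phi j) k = c * walk m phi k.
Proof.
  revert k; induction m as [|m IH]; intros k; simpl; [|rewrite !IH]; lra.
Qed.

Lemma walk_sum m (phi : nat -> Z -> R) N k :
  walk m (fun j => sum_f_R0 (fun i => phi i j) N) k =
  sum_f_R0 (fun i => walk m (phi i) k) N.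
Proof.
  induction N as [|N IH]; simpl; [reflexivity|].
  now rewrite walk_plus, IH.
Qed.

Lemma walk_shift m phi d k :
  walk m (fun j => phi (j + d)%Z) k = walk m phi (k + d)%Z.
Proof.
  revert k; induction m as [|m IH]; intros k; simpl; [reflexivity|].
  rewrite !IH; do 2 f_equal; [f_equal|]; f_equal; lia.
Qed.

Lemma walk_reflect m phi k :
  walk m (fun j => phi (- j)%Z) k = walk m phi (- k)%Z.
Proof.
  revert k; induction m as [|m IH]; intros k; simpl; [reflexivity|].
  rewrite !IH.
  replace (- (k - 1))%Z with (- k + 1)%Z by lia.
  replace (- (k + 1))%Z with (- k - 1)%Z by lia. lra.
Qed.

(** The functions j |-> cos (2 j y) are eigenfunctions of one step, with
    eigenvalue (1 + cos (2 y)) / 2 = cos^2 y. *)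
Lemma walk_cos m y k :
  walk m (fun j => cos (2 * IZR j * y)) k = cos y ^ (2 * m) * cos (2 * IZR k * y).
Proof.
  revert k; induction m as [|m IH]; intros k.
  - simpl; lra.
  - cbn [walk]; rewrite !IH, minus_IZR, plus_IZR.
    replace (2 * (IZR k - 1) * y) with (2 * IZR k * y - 2 * y) by ring.
    replace (2 * (IZR k + 1) * y) with (2 * IZR k * y + 2 * y) by ring.
    rewrite cos_minus, cos_plus, cos_2a_cos.
    replace (2 * S m)%nat with (S (S (2 * m))) by lia.
    cbn [pow]; field.
Qed.

(** The probability of being at [k] at time [m], starting from 0; it equals
    C(2m, m+k) / 4^m. *)
Definition walk_prob (m : nat) (k : Z) : R :=
  walk m (fun j => if Z.eqb j k then 1 else 0) 0.

Lemma walk_prob_at m j k :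
  walk m (fun i => if Z.eqb i k then 1 else 0) j = walk_prob m (k - j).
Proof.
  unfold walk_prob.
  rewrite <- (Z.add_0_l j) at 1.
  rewrite <- (walk_shift m (fun i => if Z.eqb i k then 1 else 0) j 0).
  apply walk_ext; intros i _.
  destruct (Z.eqb_spec (i + j) k), (Z.eqb_spec i (k - j)); lia || reflexivity.
Qed.

Lemma walk_prob_S m k :
  walk_prob (S m) k =
  (walk_prob m (k - 1) + 2 * walk_prob m k + walk_prob m (k + 1)) / 4.
Proof.
  unfold walk_prob at 1; cbn [walk]; rewrite !walk_prob_at.
  replace (k - (0 - 1))%Z with (k + 1)%Z by lia.
  replace (k - (0 + 1))%Z with (k - 1)%Z by lia.
  rewrite Z.sub_0_r; lra.
Qed.

Lemma walk_prob_opp m k : walk_prob m (- k) = walk_prob m k.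
Proof.
  unfold walk_prob.
  transitivity (walk m (fun j => if Z.eqb (- j) k then 1 else 0) 0).
  - apply walk_ext; intros j _.
    destruct (Z.eqb_spec j (- k)), (Z.eqb_spec (- j) k); lia || reflexivity.
  - apply (walk_reflect m (fun j => if Z.eqb j k then 1 else 0) 0).
Qed.

(** The ratio of consecutive binomial coefficients C(2m, m+k); the instances at
    k - 1, k and k + 1 for [m] give the one at [k] for [m + 1] by linear
    combination. *)
Lemma walk_prob_ratio m k :
  (INR m + IZR k + 1) * walk_prob m (k + 1) = (INR m - IZR k) * walk_prob m k.
Proof.
  revert k; induction m as [|m IH]; intros k.
  - unfold walk_prob; cbn [walk INR].
    destruct (Z.eqb_spec 0 (k + 1)) as [e|_], (Z.eqb_spec 0 k) as [e'|_].
    + lia.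
    + replace k with (-1)%Z by lia; lra.
    + rewrite <- e'; lra.
    + lra.
  - rewrite !walk_prob_S, S_INR.
    pose proof (IH (k - 1)%Z) as H1. pose proof (IH k) as H2.
    pose proof (IH (k + 1)%Z) as H3.
    replace (k - 1 + 1)%Z with k in H1 by lia.
    replace (k + 1 - 1)%Z with k by lia.
    rewrite minus_IZR in H1; rewrite plus_IZR in H3.
    lra.
Qed.

(** C(2m, m+k) / C(2m, m) as a product; it vanishes for k > m because of the
    factor at index m. *)
Fixpoint walk_ratio (m k : nat) : R :=
  match k with
  | O => 1
  | S k => walk_ratio m k * ((INR m - INR k) / (INR m + INR k + 1))
  end.

Lemma walk_prob_closed m k :
  walk_prob m (Z.of_nat k) = walk_prob m 0 * walk_ratio m k.
Proof.
  induction k as [|k IH]; [simpl; lra|].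
  pose proof (walk_prob_ratio m (Z.of_nat k)) as H.
  rewrite IH, <- INR_IZR_INZ in H.
  replace (Z.of_nat k + 1)%Z with (Z.of_nat (S k)) in H by lia.
  pose proof (pos_INR m); pose proof (pos_INR k).
  cbn [walk_ratio].
  apply (Rmult_eq_reg_l (INR m + INR k + 1)); [|lra].
  rewrite H; field; lra.
Qed.

Lemma walk_ratio_zero m k : (m < k)%nat -> walk_ratio m k = 0.
Proof.
  induction k as [|k IH]; [lia|]; intros H; cbn [walk_ratio].
  destruct (Nat.eq_dec m k) as [->|n].
  - unfold Rdiv; rewrite Rminus_diag; ring.
  - rewrite IH by lia; ring.
Qed.

Lemma walk_ratio_ge0 m k : 0 <= walk_ratio m k.
Proof.
  destruct (Nat.le_gt_cases k m) as [H|H]; [|rewrite walk_ratio_zero by lia; lra].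
  induction k as [|k IH]; cbn [walk_ratio]; [lra|].
  apply Rmult_le_pos; [apply IH; lia|].
  apply le_INR in H; rewrite S_INR in H; pose proof (pos_INR k).
  apply Rmult_le_pos; [lra|]; left; apply Rinv_0_lt_compat; lra.
Qed.

(** Each factor is 1 - (2 j + 1) / (m + j + 1) <= exp (- (2 j + 1) / (m + k)), and
    the odd numbers add up to a square. *)
Lemma walk_ratio_upper m k j :
  (j <= k)%nat -> (k <= m)%nat ->
  walk_ratio m j <= exp (- (INR j ^ 2 / (INR m + INR k))).
Proof.
  intros Hj Hk; induction j as [|j IH].
  - simpl. rewrite Rmult_0_l; unfold Rdiv; rewrite Rmult_0_l, Ropp_0, exp_0; lra.
  - cbn [walk_ratio].
    pose proof (pos_INR j).
    assert (INR j + 1 <= INR k) by (rewrite <- S_INR; apply le_INR; lia).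
    assert (INR k <= INR m) by (apply le_INR; lia).
    rewrite S_INR.
    replace (- ((INR j + 1) ^ 2 / (INR m + INR k))) with
      (- (INR j ^ 2 / (INR m + INR k)) + - ((2 * INR j + 1) / (INR m + INR k)))
      by (field; lra).
    rewrite exp_plus.
    apply Rmult_le_compat.
    + apply walk_ratio_ge0.
    + apply Rmult_le_pos; [lra|]; left; apply Rinv_0_lt_compat; lra.
    + apply IH; lia.
    + apply Rle_trans with (2 := exp_ineq1_le _).
      replace ((INR m - INR j) / (INR m + INR j + 1)) with
        (1 - (2 * INR j + 1) * / (INR m + INR j + 1)) by (field; lra).
      unfold Rdiv. apply Rplus_le_compat_l, Ropp_le_contravar.
      apply Rmult_le_compat_l; [lra|]. apply Rinv_le_contravar; lra.
Qed.

(** The inverse of each factor is 1 + (2 j + 1) / (m - j), at most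
    exp ((2 j + 1) / (m - k + 1)). *)
Lemma walk_ratio_lower m k j :
  (j <= k)%nat -> (k <= m)%nat ->
  exp (- (INR j ^ 2 / (INR m - INR k + 1))) <= walk_ratio m j.
Proof.
  intros Hj Hk; induction j as [|j IH].
  - simpl. rewrite Rmult_0_l; unfold Rdiv; rewrite Rmult_0_l, Ropp_0, exp_0; lra.
  - cbn [walk_ratio].
    pose proof (pos_INR j).
    assert (INR j + 1 <= INR k) by (rewrite <- S_INR; apply le_INR; lia).
    assert (INR k <= INR m) by (apply le_INR; lia).
    rewrite S_INR.
    replace (- ((INR j + 1) ^ 2 / (INR m - INR k + 1))) with
      (- (INR j ^ 2 / (INR m - INR k + 1)) + - ((2 * INR j + 1) / (INR m - INR k + 1)))
      by (field; lra).
    rewrite exp_plus.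
    apply Rmult_le_compat; try (left; apply exp_pos).
    + apply IH; lia.
    + rewrite exp_Ropp.
      replace ((INR m - INR j) / (INR m + INR j + 1)) with
        (/ (1 + (2 * INR j + 1) * / (INR m - INR j))) by (field; lra).
      assert (0 < / (INR m - INR j)) by (apply Rinv_0_lt_compat; lra).
      apply Rinv_le_contravar.
      { assert (0 <= (2 * INR j + 1) * / (INR m - INR j)) by (apply Rmult_le_pos; lra). lra. }
      apply Rle_trans with (2 := exp_ineq1_le _).
      unfold Rdiv. apply Rplus_le_compat_l.
      apply Rmult_le_compat_l; [lra|]. apply Rinv_le_contravar; lra.
Qed.

(** * Fourier analysis on Z / l *)

(** 2 sin y cos (2 v y) = sin ((2 v + 1) y) - sin ((2 v - 1) y). *)
Lemma sum_cos_telescope (y : R) (N : nat) :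
  2 * sin y * sum_f_R0 (fun v => cos (2 * INR v * y)) N =
  sin ((2 * INR N + 1) * y) + sin y.
Proof.
  induction N as [|N IH].
  - simpl. replace (2 * 0 * y) with 0 by ring.
    replace ((2 * 0 + 1) * y) with y by ring. rewrite cos_0; ring.
  - cbn [sum_f_R0]. rewrite Rmult_plus_distr_l, IH, S_INR.
    replace ((2 * (INR N + 1) + 1) * y) with (2 * (INR N + 1) * y + y) by ring.
    replace ((2 * INR N + 1) * y) with (2 * (INR N + 1) * y - y) by ring.
    rewrite sin_plus, sin_minus; ring.
Qed.

Lemma sin_pi_div_neq0 (l : nat) (k : Z) :
  (0 < l)%nat -> ~ (Z.of_nat l | k)%Z -> sin (PI * IZR k / INR l) <> 0.
Proof.
  intros Hl Hk H. apply sin_eq_0_0 in H as [q Hq].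
  apply Hk; exists q. apply eq_IZR; rewrite mult_IZR, <- INR_IZR_INZ.
  assert (0 < INR l) by (apply lt_0_INR; lia).
  pose proof PI_RGT_0.
  apply (Rmult_eq_reg_l (PI / INR l)).
  2: { apply Rgt_not_eq; unfold Rdiv; apply Rmult_lt_0_compat; auto.
       apply Rinv_0_lt_compat; lra. }
  transitivity (PI * IZR k / INR l); [field; lra|].
  rewrite Hq; field; lra.
Qed.

Lemma sin_IZR_PI (k : Z) : sin (IZR k * PI) = 0.
Proof. apply sin_eq_0_1; now exists k. Qed.

Lemma cos_2IZR_PI (k : Z) : cos (2 * IZR k * PI) = 1.
Proof.
  replace (2 * IZR k * PI) with (2 * (IZR k * PI)) by ring.
  rewrite cos_2a_sin, sin_IZR_PI; ring.
Qed.

(** Orthogonality of the characters of Z / l, in real form. *)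
Lemma sum_cos_root (l : nat) (k : Z) :
  (0 < l)%nat ->
  sum_f_R0 (fun v => cos (2 * IZR k * (PI * INR v / INR l))) (l - 1) =
  INR l * (if Z.eqb (k mod Z.of_nat l) 0 then 1 else 0).
Proof.
  intros Hl.
  assert (0 < INR l) by (apply lt_0_INR; lia).
  destruct (Z.eqb_spec (k mod Z.of_nat l) 0) as [e|ne].
  - apply Z.mod_divide in e as [q ->]; [|lia].
    rewrite (sum_eq _ (fun _ => 1)).
    + rewrite sum_cte. replace (S (l - 1)) with l by lia. ring.
    + intros v _. rewrite mult_IZR, <- INR_IZR_INZ.
      transitivity (cos (2 * IZR (q * Z.of_nat v) * PI)).
      * f_equal. rewrite mult_IZR, <- INR_IZR_INZ. field; lra.
      * apply cos_2IZR_PI.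
  - rewrite Rmult_0_r.
    set (y := PI * IZR k / INR l).
    assert (Hs : sin y <> 0).
    { apply sin_pi_div_neq0; auto. intros D; apply ne.
      apply Z.mod_divide; [lia|auto]. }
    pose proof (sum_cos_telescope y (l - 1)) as T.
    replace (sin ((2 * INR (l - 1) + 1) * y)) with (- sin y) in T.
    + rewrite (sum_eq _ (fun v => cos (2 * INR v * y))).
      * apply (Rmult_eq_reg_l (2 * sin y)); [|lra]. rewrite T; ring.
      * intros v _. f_equal. unfold y; field; lra.
    + rewrite minus_INR by lia. simpl (INR 1).
      replace ((2 * (INR l - 1) + 1) * y) with (2 * IZR k * PI - y)
        by (unfold y; field; lra).
      rewrite sin_minus, cos_2IZR_PI.
      replace (2 * IZR k * PI) with (IZR (2 * k) * PI) by (rewrite mult_IZR; ring).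
      rewrite sin_IZR_PI; ring.
Qed.

(** For an odd number of equidistant angles the terms v and 2 p + 1 - v agree, so
    the angles in [0, pi / 2) suffice; there cos is nonnegative and below a
    Gaussian. *)
Lemma cos_sum_symmetric (f : R -> R) (p : nat) :
  (forall y, f (PI - y) = f y) ->
  sum_f_R0 (fun v => f (PI * INR v / INR (2 * p + 1))) (2 * p) =
  2 * sum_f_R0 (fun v => f (PI * INR v / INR (2 * p + 1))) p - f 0.
Proof.
  intros Hf.
  set (F := fun v => f (PI * INR v / INR (2 * p + 1))).
  assert (Fs : forall v, (v <= 2 * p + 1)%nat -> F (2 * p + 1 - v)%nat = F v).
  { intros v Hv; unfold F. rewrite <- (Hf (PI * INR v / _)); f_equal.
    rewrite minus_INR by lia. field. apply not_0_INR; lia. }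
  assert (F0 : F 0%nat = f 0) by (unfold F; f_equal; simpl; unfold Rdiv; ring).
  (* the terms above p mirror those from 1 to p *)
  assert (H : forall q, (q <= p)%nat ->
    sum_f_R0 F (p + q) = sum_f_R0 F p + (sum_f_R0 F p - sum_f_R0 F (p - q))).
  { induction q as [|q IH]; intros Hq.
    - rewrite Nat.add_0_r, Nat.sub_0_r; lra.
    - rewrite Nat.add_succ_r; cbn [sum_f_R0]. rewrite IH by lia.
      replace (p - q)%nat with (S (p - S q)) by lia. cbn [sum_f_R0].
      rewrite <- (Fs (S (p + q))) by lia.
      replace (2 * p + 1 - S (p + q))%nat with (S (p - S q)) by lia. lra. }
  replace (2 * p)%nat with (p + p)%nat by lia.
  rewrite (H p) by lia. rewrite Nat.sub_diag. cbn [sum_f_R0].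
  rewrite F0; lra.
Qed.
(** * Dominated convergence for series *)

Lemma ex_series_dominated (a M : nat -> R) :
  (forall n, Rabs (a n) <= M n) -> ex_series M -> ex_series a.
Proof. exact (ex_series_le a M). Qed.

Lemma sum_n_is_lim (a : nat -> nat -> R) (b : nat -> R) (N : nat) :
  (forall v, is_lim_seq (fun m => a m v) (b v)) ->
  is_lim_seq (fun m => sum_n (a m) N) (sum_n b N).
Proof.
  intros H; induction N as [|N IH].
  -
    rewrite sum_O; apply is_lim_seq_ext with (u := fun m => a m 0%nat); [|apply H].
    intros m; now rewrite sum_O.
  - rewrite sum_Sn.
    apply is_lim_seq_ext with (u := fun m => sum_n (a m) N + a m (S N)).
    + intros m; now rewrite sum_Sn.
    + apply (is_lim_seq_plus' _ _ (sum_n b N) (b (S N))); auto.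
Qed.

(** Tannery's theorem. *)
Lemma Series_dominated (a : nat -> nat -> R) (b M : nat -> R) :
  (forall v, is_lim_seq (fun m => a m v) (b v)) ->
  (forall m v, Rabs (a m v) <= M v) -> ex_series M ->
  is_lim_seq (fun m => Series (a m)) (Series b).
Proof.
  intros Hlim Hdom HM.
  assert (Hb : forall v, Rabs (b v) <= M v).
  { intros v. apply (is_lim_seq_le (fun m => Rabs (a m v)) (fun _ => M v)
      (Rabs (b v)) (M v)); auto.
    - apply (is_lim_seq_abs _ (b v)), Hlim.
    - apply is_lim_seq_const. }
  assert (ea : forall m, ex_series (a m)) by (intros m; apply (ex_series_dominated _ M); auto).
  assert (eb : ex_series b) by (apply (ex_series_dominated _ M); auto).
  assert (tail : forall (c : nat -> R) N, (forall v, Rabs (c v) <= M v) ->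
    Rabs (Series c - sum_n c N) <= Series M - sum_n M N).
  { intros c N Hc.
    assert (ec : ex_series c) by (apply (ex_series_dominated _ M); auto).
    rewrite (Series_incr_n c (S N)), (Series_incr_n M (S N)) by (auto; lia).
    rewrite !sum_n_Reals; simpl pred.
    replace (_ + _ - _) with (Series (fun k => c (S N + k)%nat)) by ring.
    replace (_ + _ - _) with (Series (fun k => M (S N + k)%nat)) by ring.
    assert (ex_series (fun k => M (S N + k)%nat)) by (apply (ex_series_incr_n M); auto).
    apply Rle_trans with (Series (fun k => Rabs (c (S N + k)%nat))).
    - apply Series_Rabs. apply (ex_series_dominated _ (fun k => M (S N + k)%nat)); auto.
      intros k. rewrite Rabs_Rabsolu; apply Hc.
    - apply Series_le; auto. intros k; split; [apply Rabs_pos|apply Hc]. }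
  assert (HMl : is_lim_seq (fun N => sum_n M N) (Series M)) by apply (Series_correct _ HM).
  apply is_lim_seq_spec; intros eps.
  apply is_lim_seq_spec in HMl.
  destruct (HMl (mkposreal (eps / 3) ltac:(destruct eps; simpl; lra))) as [N HN].
  specialize (HN N (Nat.le_refl _)); simpl in HN.
  assert (L := sum_n_is_lim a b N Hlim). apply is_lim_seq_spec in L.
  destruct (L (mkposreal (eps / 3) ltac:(destruct eps; simpl; lra))) as [m0 Hm0].
  exists m0; intros m Hm. specialize (Hm0 m Hm); simpl in Hm0.
  pose proof (tail (a m) N (Hdom m)). pose proof (tail b N Hb).
  apply Rabs_def2 in HN as [HN1 HN2]. apply Rabs_def2 in Hm0 as [Hm1 Hm2].
  apply Rabs_le_between in H. apply Rabs_le_between in H0.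
  apply Rabs_def1; lra.
Qed.
Lemma sum_indicator_multiples (l : nat) (k : Z) (J : nat) :
  (0 < l)%nat ->
  sum_f_R0 (fun j => if Z.eqb k (Z.of_nat (l * j)) then 1 else 0) J =
  if (Z.eqb (k mod Z.of_nat l) 0 && Z.leb 0 k && Z.leb k (Z.of_nat (l * J)))%bool
  then 1 else 0.
Proof.
  intros Hl; induction J as [|J IH].
  - cbn [sum_f_R0]. rewrite Nat.mul_0_r.
    destruct (Z.eqb_spec k (Z.of_nat 0)) as [->|n].
    + rewrite Zmod_0_l; reflexivity.
    + destruct (Z.leb_spec 0 k), (Z.leb_spec k (Z.of_nat 0));
        rewrite ?Bool.andb_false_r; try reflexivity; lia.
  - cbn [sum_f_R0]; rewrite IH.
    destruct (Z.eqb_spec k (Z.of_nat (l * S J))) as [->|n].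
    + rewrite Nat2Z.inj_mul, Z.mul_comm, Z_mod_mult, Z.leb_refl.
      destruct (Z.leb_spec 0 (Z.of_nat (S J) * Z.of_nat l)); [|lia].
      destruct (Z.leb_spec (Z.of_nat (S J) * Z.of_nat l) (Z.of_nat (l * J))); [lia|].
      simpl; lra.
    + destruct (Z.eqb_spec (k mod Z.of_nat l) 0) as [e|ne]; [|simpl; lra].
      apply Z.mod_divide in e as [q Hq]; [|lia].
      destruct (Z.leb_spec 0 k); [|simpl; lra].
      replace (Z.leb k (Z.of_nat (l * S J))) with (Z.leb k (Z.of_nat (l * J)));
        [simpl; lra|].
      rewrite !Nat2Z.inj_mul in *.
      assert (q <= Z.of_nat J \/ q > Z.of_nat (S J))%Z by
        (assert (q <> Z.of_nat (S J)) by (intros ->; apply n; lia); lia).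
      destruct (Z.leb_spec k (Z.of_nat l * Z.of_nat J)),
        (Z.leb_spec k (Z.of_nat l * Z.of_nat (S J))); try reflexivity; nia.
Qed.

(** Up to time [m] the walk stays in [-m, m], where the indicator of l Z is the sum
    of the indicators of the points l j and - l j with j <= m; the point 0 is
    counted twice. *)
Lemma walk_multiples (l m : nat) :
  (0 < l)%nat ->
  walk m (fun k => if Z.eqb (k mod Z.of_nat l) 0 then 1 else 0) 0 =
  walk_prob m 0 * (2 * sum_f_R0 (fun j => walk_ratio m (l * j)) m - 1).
Proof.
  intros Hl.
  set (S := fun k => sum_f_R0 (fun j => if Z.eqb k (Z.of_nat (l * j)) then 1 else 0) m).
  set (S' := fun k => sum_f_R0 (fun j => if Z.eqb k (- Z.of_nat (l * j)) then 1 else 0) m).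
  transitivity (walk m (fun k => (S k + S' k) + (-1) * (if Z.eqb k 0 then 1 else 0)) 0).
  - apply walk_ext; intros k Hk.
    assert (E' : S' k = S (- k)%Z).
    { apply sum_eq; intros j _.
      destruct (Z.eqb_spec k (- Z.of_nat (l * j))), (Z.eqb_spec (- k) (Z.of_nat (l * j)));
        reflexivity || lia. }
    rewrite E'; unfold S; rewrite !sum_indicator_multiples by auto.
    assert (Hm : (Z.of_nat m <= Z.of_nat (l * m))%Z) by nia.
    destruct (Z.leb_spec k (Z.of_nat (l * m))); [|lia].
    destruct (Z.leb_spec (- k) (Z.of_nat (l * m))); [|lia].
    assert (D : Z.eqb (- k mod Z.of_nat l) 0 = Z.eqb (k mod Z.of_nat l) 0).
    { apply Bool.eq_true_iff_eq; rewrite !Z.eqb_eq, !Z.mod_divide by lia.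
      apply Z.divide_opp_r. }
    rewrite D.
    destruct (Z.eqb_spec k 0) as [->|n].
    + rewrite Zmod_0_l; simpl; lra.
    + destruct (Z.eqb (k mod Z.of_nat l) 0), (Z.leb_spec 0 k), (Z.leb_spec 0 (- k));
        simpl; lra || lia.
  - rewrite !walk_plus, walk_scal; unfold S, S'.
    rewrite (walk_sum m (fun j k => if Z.eqb k (Z.of_nat (l * j)) then 1 else 0)).
    rewrite (walk_sum m (fun j k => if Z.eqb k (- Z.of_nat (l * j)) then 1 else 0)).
    fold (walk_prob m 0).
    rewrite (sum_eq (fun i => walk m _ _) (fun j => walk_ratio m (l * j) * walk_prob m 0)).
    2: { intros j _; change (walk_prob m (Z.of_nat (l * j)) = walk_ratio m (l * j) * walk_prob m 0).
         rewrite walk_prob_closed; ring. }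
    rewrite (sum_eq (fun i => walk m (fun k => if Z.eqb k (- _) then _ else _) _)
      (fun j => walk_ratio m (l * j) * walk_prob m 0)).
    2: { intros j _; change (walk_prob m (- Z.of_nat (l * j)) = walk_ratio m (l * j) * walk_prob m 0).
         rewrite walk_prob_opp, walk_prob_closed; ring. }
    rewrite <- scal_sum; ring.
Qed.

(** A finite version of the theta functional equation: [walk] applied to the
    indicator of l Z, l = 2 p + 1, is computed on both sides of Fourier duality. *)
Lemma finite_theta (p m : nat) :
  2 * sum_f_R0 (fun v => cos (PI * INR v / INR (2 * p + 1)) ^ (2 * m)) p - 1 =
  INR (2 * p + 1) * walk_prob m 0 *
  (2 * sum_f_R0 (fun j => walk_ratio m ((2 * p + 1) * j)) m - 1).
Proof.
  set (l := (2 * p + 1)%nat).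
  rewrite Rmult_assoc, <- walk_multiples by lia.
  rewrite <- walk_scal.
  transitivity (walk m (fun k =>
    sum_f_R0 (fun v => cos (2 * IZR k * (PI * INR v / INR l))) (l - 1)) 0).
  - rewrite (walk_sum m (fun v k => cos (2 * IZR k * (PI * INR v / INR l)))).
    rewrite (sum_eq (fun i => walk m _ _) (fun v => cos (PI * INR v / INR l) ^ (2 * m))).
    2: { intros v _; rewrite walk_cos.
         rewrite Rmult_0_r, Rmult_0_l, cos_0; ring. }
    replace (l - 1)%nat with (2 * p)%nat by lia.
    unfold l; rewrite (cos_sum_symmetric (fun y => cos y ^ (2 * m))).
    + rewrite cos_0, pow1; reflexivity.
    + intros y. rewrite Rtrigo_facts.cos_pi_minus.
      rewrite !pow_mult. f_equal. ring.
  - apply walk_ext; intros k _. rewrite sum_cos_root by lia. reflexivity.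
Qed.

(** * Gaussian bounds *)

Lemma exp_pow x n : exp x ^ n = exp (INR n * x).
Proof.
  induction n as [|n IH]; [simpl; now rewrite Rmult_0_l, exp_0|].
  rewrite S_INR, <- tech_pow_Rmult, IH, <- exp_plus; f_equal; ring.
Qed.

Lemma ex_series_gauss (c : R) : 0 < c -> ex_series (fun n => exp (- (c * INR n ^ 2))).
Proof.
  intros Hc.
  apply (ex_series_le (fun n => exp (- (c * INR n ^ 2))) (fun n => exp (- c) ^ n)).
  - intros n; unfold norm; simpl; unfold abs; simpl.
    rewrite Rabs_pos_eq by (left; apply exp_pos).
    rewrite exp_pow. apply exp_le_compat.
    enough (INR n <= INR n ^ 2) by nra.
    rewrite <- pow_INR; apply le_INR; simpl; nia.
  - apply ex_series_geom. rewrite Rabs_pos_eq by (left; apply exp_pos).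
    rewrite <- exp_0; apply exp_increasing; lra.
Qed.
Lemma sin_ge_mul_cos y : 0 <= y <= PI -> y * cos y <= sin y.
Proof.
  intros [[H0|<-] H1]; [|rewrite sin_0; lra].
  destruct (MVT_cor2 (fun t => sin t - t * cos t) (fun t => t * sin t) 0 y H0)
    as [c [Hc [c0 c1]]].
  - intros c _; apply is_derive_Reals; auto_derive; [trivial|ring].
  - rewrite sin_0 in Hc.
    assert (0 <= sin c) by (apply sin_ge_0; lra).
    assert (0 <= c * sin c * (y - 0)) by (apply Rmult_le_pos; [apply Rmult_le_pos|]; lra).
    lra.
Qed.

(** exp (y^2 / 2) cos y has derivative exp (y^2 / 2) (y cos y - sin y) <= 0. *)
Lemma cos_le_gauss y : 0 <= y <= PI -> cos y <= exp (- (y ^ 2 / 2)).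
Proof.
  intros [[H0|<-] H1].
  2: { replace (- (0 ^ 2 / 2)) with 0 by field. rewrite cos_0, exp_0; lra. }
  destruct (MVT_cor2 (fun t => exp (t ^ 2 / 2) * cos t)
    (fun t => exp (t ^ 2 / 2) * (t * cos t - sin t)) 0 y H0) as [c [Hc [c0 c1]]].
  - intros c _; apply is_derive_Reals; auto_derive; [trivial|].
    unfold Rdiv; cbn [pow]; field.
  - replace (0 ^ 2 / 2) with 0 in Hc by field. rewrite exp_0, cos_0 in Hc.
    pose proof (sin_ge_mul_cos c ltac:(lra)).
    pose proof (exp_pos (c ^ 2 / 2)).
    assert (Hle : exp (y ^ 2 / 2) * cos y <= 1).
    { assert (0 <= exp (c ^ 2 / 2) * (sin c - c * cos c) * (y - 0))
        by (apply Rmult_le_pos; [apply Rmult_le_pos|]; lra).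
      lra. }
    pose proof (exp_pos (y ^ 2 / 2)).
    rewrite exp_Ropp. apply (Rmult_le_reg_l (exp (y ^ 2 / 2))); auto.
    rewrite Rinv_r; lra.
Qed.

Lemma exp_le_one_minus x : x < 1 -> exp (- (x / (1 - x))) <= 1 - x.
Proof.
  intros Hx. rewrite exp_Ropp.
  replace (1 - x) with (/ (1 + x / (1 - x))) at 2 by (field; lra).
  apply Rinv_le_contravar; [|apply exp_ineq1_le].
  replace (1 + x / (1 - x)) with (/ (1 - x)) by (field; lra).
  apply Rinv_0_lt_compat; lra.
Qed.

Lemma cos_ge_gauss y :
  0 <= y -> y ^ 2 / 2 < 1 -> exp (- (y ^ 2 / 2 / (1 - y ^ 2 / 2))) <= cos y.
Proof.
  intros H0 H1. apply Rle_trans with (1 := exp_le_one_minus _ H1).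
  replace y with (2 * (y / 2)) at 2 by field. rewrite cos_2a_sin.
  assert (Hy : y < 2) by nra. pose proof PI2_1.
  assert (0 <= sin (y / 2) <= y / 2).
  { split; [apply sin_ge_0; lra|].
    destruct H0 as [H0|<-]; [left; apply sin_lt_x; lra|].
    replace (0 / 2) with 0 by field; rewrite sin_0; lra. }
  nra.
Qed.

(** * The functional equation of theta *)

(** At time m + 1 the modulus is an odd number within 3 of sqrt (a (m + 1)), so that
    modulus^2 / (m + 1) tends to [a]; being at least sqrt (a (m + 1)) it also gives
    the uniform bounds. *)
Definition half_modulus (a : R) (m : nat) : nat := Z.to_nat (up (sqrt a * sqrt (INR (S m)) / 2)).
Definition modulus (a : R) (m : nat) : nat := (2 * half_modulus a m + 1)%nat.
Definition scaled_modulus (a : R) (m : nat) : R := INR (modulus a m) * / sqrt (INR (S m)).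

Lemma sqrt_S_pos m : 0 < sqrt (INR (S m)).
Proof. apply sqrt_lt_R0, lt_0_INR; lia. Qed.

Lemma scaled_modulus_bounds a m :
  sqrt a <= scaled_modulus a m <= sqrt a + 3 * / sqrt (INR (S m)).
Proof.
  pose proof (sqrt_S_pos m) as H. pose proof (sqrt_pos a).
  unfold scaled_modulus, modulus, half_modulus.
  set (x := sqrt a * sqrt (INR (S m)) / 2).
  assert (Hx : 0 <= x) by (unfold x; apply Rmult_le_pos; [apply Rmult_le_pos|]; lra).
  destruct (archimed x) as [H1 H2].
  assert (Hu : (0 <= up x)%Z) by (apply le_IZR; lra).
  rewrite plus_INR, mult_INR, (INR_IZR_INZ (Z.to_nat _)), Z2Nat.id by auto. simpl (INR 1); simpl (INR 2).
  replace (sqrt a) with (2 * x * / sqrt (INR (S m))) by (unfold x; field; lra).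
  assert (0 < / sqrt (INR (S m))) by now apply Rinv_0_lt_compat.
  split; [apply Rmult_le_compat_r; lra|].
  rewrite <- Rmult_plus_distr_r. apply Rmult_le_compat_r; lra.
Qed.

Lemma inv_sqrt_S_lim : is_lim_seq (fun m => / sqrt (INR (S m))) 0.
Proof.
  apply (is_lim_seq_inv _ p_infty); [|discriminate].
  apply (filterlim_comp _ _ _ (fun m => INR (S m)) sqrt _ (Rbar_locally p_infty)).
  - apply (is_lim_seq_incr_1 INR), is_lim_seq_INR.
  - apply filterlim_sqrt_p.
Qed.

Lemma inv_sqrt_S_bounds m : 0 < / sqrt (INR (S m)) <= 1.
Proof.
  split; [apply Rinv_0_lt_compat, sqrt_S_pos|].
  rewrite <- Rinv_1. apply Rinv_le_contravar; [lra|].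
  rewrite <- sqrt_1. apply sqrt_le_1_alt. rewrite S_INR; pose proof (pos_INR m); lra.
Qed.

Lemma scaled_modulus_lim a : is_lim_seq (scaled_modulus a) (sqrt a).
Proof.
  apply (is_lim_seq_le_le (fun _ => sqrt a) _ (fun m => sqrt a + 3 * / sqrt (INR (S m)))).
  - intros m; apply scaled_modulus_bounds.
  - apply is_lim_seq_const.
  - replace (Finite (sqrt a)) with (Finite (sqrt a + 3 * 0)) by (f_equal; ring).
    apply is_lim_seq_plus'; [apply is_lim_seq_const|].
    apply is_lim_seq_mult'; [apply is_lim_seq_const|apply inv_sqrt_S_lim].
Qed.

Lemma exp_lim (u : nat -> R) (l : R) :
  is_lim_seq u l -> is_lim_seq (fun m => exp (u m)) (exp l).
Proof.
  intros H; apply (is_lim_seq_continuous exp u l); auto.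
  apply derivable_continuous_pt, derivable_pt_exp.
Qed.

Lemma eventually_lt (u : nat -> R) (l c : R) :
  is_lim_seq u l -> l < c -> eventually (fun m => u m < c).
Proof.
  intros H Hc. apply (H (fun x => x < c)). apply open_lt; auto.
Qed.
Lemma exp_opp_lim (u : nat -> R) (l : R) :
  is_lim_seq u l -> is_lim_seq (fun m => exp (- u m)) (exp (- l)).
Proof. intros H. apply exp_lim. now apply (is_lim_seq_opp u l) in H. Qed.

Lemma Series_truncated (f : nat -> R) (N : nat) :
  Series (fun v => if Nat.leb v N then f v else 0) = sum_f_R0 f N.
Proof.
  apply is_series_unique.
  change (is_lim_seq (sum_n (fun v => if Nat.leb v N then f v else 0)) (sum_f_R0 f N)).
  apply (is_lim_seq_ext_loc (fun _ => sum_f_R0 f N)); [|apply is_lim_seq_const].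
  exists N; intros n Hn. rewrite sum_n_Reals.
  induction Hn as [|n Hn IH].
  - apply sum_eq; intros i Hi. destruct (Nat.leb_spec i N); [reflexivity|lia].
  - cbn [sum_f_R0]. rewrite <- IH.
    destruct (Nat.leb_spec (S n) N); [lia|]. now rewrite Rplus_0_r.
Qed.

Lemma modulus_scaled a m : INR (modulus a m) = scaled_modulus a m / / sqrt (INR (S m)).
Proof. unfold scaled_modulus. pose proof (sqrt_S_pos m). field. lra. Qed.

Lemma INR_S_inv_sqrt m : INR (S m) = / (/ sqrt (INR (S m))) ^ 2.
Proof.
  pose proof (sqrt_S_pos m).
  rewrite pow_inv, Rinv_inv. rewrite pow2_sqrt; [reflexivity|apply pos_INR].
Qed.

(** With y = pi v / l and M = m + 1 the quantity M y^2 equals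
    pi^2 v^2 / scaled_modulus^2, and cos^(2M) y lies between exp (- M y^2 / (1 - y^2 / 2))
    and exp (- M y^2). *)
Lemma cos_sum_lim a : 0 < a ->
  is_lim_seq
    (fun m => sum_f_R0 (fun v => cos (PI * INR v / INR (modulus a m)) ^ (2 * S m))
                (half_modulus a m))
    (Series (fun v => exp (- (PI ^ 2 / a * INR v ^ 2)))).
Proof.
  intros Ha. pose proof (sqrt_lt_R0 a Ha) as Hs. pose proof PI_RGT_0 as Hpi.
  assert (Hu : forall m, 0 < scaled_modulus a m)
    by (intros m; pose proof (scaled_modulus_bounds a m); lra).
  set (y := fun m v => PI * INR v * / sqrt (INR (S m)) * / scaled_modulus a m).
  assert (Hy : forall m v, PI * INR v / INR (modulus a m) = y m v).
  { intros m v; rewrite modulus_scaled; unfold y.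
    pose proof (Hu m). pose proof (sqrt_S_pos m). field. split; lra. }
  assert (Hy0 : forall m v, 0 <= y m v).
  { intros m v; unfold y.
    pose proof (pos_INR v); pose proof (inv_sqrt_S_bounds m).
    pose proof (Rinv_0_lt_compat _ (Hu m)).
    apply Rmult_le_pos; [apply Rmult_le_pos; [apply Rmult_le_pos|]|]; lra. }
  assert (HMy : forall m v, INR (S m) * y m v ^ 2 = PI ^ 2 * INR v ^ 2 / scaled_modulus a m ^ 2).
  { intros m v; rewrite INR_S_inv_sqrt; unfold y. pose proof (inv_sqrt_S_bounds m).
    pose proof (Hu m). pose proof (sqrt_S_pos m). field. split; lra. }
  assert (Hyl : forall v, is_lim_seq (fun m => y m v) 0).
  { intros v. replace (Finite 0) with (Finite (PI * INR v * 0 * / sqrt a))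
      by (f_equal; ring).
    unfold y. apply is_lim_seq_mult'.
    - apply is_lim_seq_mult'; [apply is_lim_seq_const|apply inv_sqrt_S_lim].
    - apply (is_lim_seq_inv _ (sqrt a)); [apply scaled_modulus_lim|].
      intros E; injection E; lra. }
  assert (Hle : forall m v, (v <= half_modulus a m)%nat -> 0 <= y m v <= PI / 2).
  { intros m v Hv; split; auto. rewrite <- Hy.
    assert (INR v <= INR (half_modulus a m)) by now apply le_INR.
    unfold modulus; rewrite plus_INR, mult_INR; simpl (INR 1); simpl (INR 2).
    pose proof (pos_INR v).
    apply (Rmult_le_reg_r (2 * INR (half_modulus a m) + 1)); [lra|].
    unfold Rdiv at 1; rewrite Rmult_assoc, Rinv_l by lra. nra. }
  assert (Hup : forall m v, (v <= half_modulus a m)%nat ->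
    0 <= cos (y m v) ^ (2 * S m) <= exp (- (PI ^ 2 * INR v ^ 2 / scaled_modulus a m ^ 2))).
  { intros m v Hv. pose proof (Hle m v Hv) as Hb.
    assert (0 <= cos (y m v)) by (apply cos_ge_0; lra).
    split; [now apply pow_le|]. rewrite <- HMy.
    apply Rle_trans with (exp (- (y m v ^ 2 / 2)) ^ (2 * S m)).
    - apply pow_incr; split; auto. apply cos_le_gauss; lra.
    - rewrite exp_pow, mult_INR. right; f_equal; simpl (INR 2); field. }
  assert (E : forall m, sum_f_R0 (fun v => cos (PI * INR v / INR (modulus a m)) ^ (2 * S m))
                (half_modulus a m) =
     Series (fun v => if Nat.leb v (half_modulus a m) then cos (y m v) ^ (2 * S m) else 0)).
  { intros m. rewrite Series_truncated. apply sum_eq; intros v _; now rewrite Hy. }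
  apply (is_lim_seq_ext _ _ _ (fun m => eq_sym (E m))).
  apply Series_dominated with (M := fun v => exp (- (PI ^ 2 / (sqrt a + 3) ^ 2 * INR v ^ 2))).
  - intros v.
    assert (Ll : is_lim_seq (fun m => PI ^ 2 * INR v ^ 2 / scaled_modulus a m ^ 2)
       (PI ^ 2 / a * INR v ^ 2)).
    { replace (PI ^ 2 / a * INR v ^ 2) with (PI ^ 2 * INR v ^ 2 / (sqrt a * (sqrt a * 1))).
      - apply is_lim_seq_div'; [apply is_lim_seq_const| |nra].
        cbn [pow]. pose proof (scaled_modulus_lim a).
        apply is_lim_seq_mult'; auto. apply is_lim_seq_mult'; auto. apply is_lim_seq_const.
      - rewrite Rmult_1_r, sqrt_sqrt by lra. field; lra. }
    assert (Hev : eventually (fun m => (v <= half_modulus a m)%nat /\ y m v < 1)).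
    { apply filter_and; [|apply (eventually_lt _ 0); auto; lra].
      assert (Hev : eventually (fun m => (2 * INR v + 1) * / sqrt (INR (S m)) < sqrt a)).
      { apply (eventually_lt _ ((2 * INR v + 1) * 0)); [|rewrite Rmult_0_r; auto].
        apply is_lim_seq_mult'; [apply is_lim_seq_const|apply inv_sqrt_S_lim]. }
      revert Hev; apply filter_imp; intros m Hm.
      pose proof (scaled_modulus_bounds a m) as [Hb _].
      assert (Hlt : 2 * INR v + 1 < INR (modulus a m)).
      { apply (Rmult_lt_reg_r (/ sqrt (INR (S m)))); [apply inv_sqrt_S_bounds|].
        unfold scaled_modulus in Hb; lra. }
      unfold modulus in Hlt; rewrite plus_INR, mult_INR in Hlt.
      simpl (INR 1) in Hlt; simpl (INR 2) in Hlt.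
      apply INR_le; lra. }
    apply (is_lim_seq_le_le_loc
      (fun m => exp (- (PI ^ 2 * INR v ^ 2 / scaled_modulus a m ^ 2 / (1 - y m v ^ 2 / 2)))) _
      (fun m => exp (- (PI ^ 2 * INR v ^ 2 / scaled_modulus a m ^ 2)))).
    + revert Hev; apply filter_imp; intros m [Hv H1].
      destruct (Nat.leb_spec v (half_modulus a m)); [|lia].
      split; [|now apply Hup].
      pose proof (Hle m v Hv) as Hb.
      assert (y m v ^ 2 / 2 < 1) by nra.
      rewrite <- HMy.
      apply Rle_trans with (exp (- (y m v ^ 2 / 2 / (1 - y m v ^ 2 / 2))) ^ (2 * S m)).
      * rewrite exp_pow, mult_INR. right; f_equal; simpl (INR 2); field. nra.
      * apply pow_incr; split; [left; apply exp_pos|]. apply cos_ge_gauss; auto.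
    + apply exp_opp_lim.
      replace (PI ^ 2 / a * INR v ^ 2) with
        (PI ^ 2 / a * INR v ^ 2 / (1 - 0 * (0 * 1) / 2)) by (field; lra).
      apply is_lim_seq_div'; auto; [|lra].
      apply is_lim_seq_minus'; [apply is_lim_seq_const|].
      apply is_lim_seq_div'; [|apply is_lim_seq_const|lra].
      cbn [pow]; repeat apply is_lim_seq_mult'; auto. apply is_lim_seq_const.
    + now apply exp_opp_lim.
  - intros m v. destruct (Nat.leb_spec v (half_modulus a m)) as [Hv|_].
    + pose proof (Hup m v Hv) as [H0 H1]. rewrite Rabs_pos_eq by auto.
      apply Rle_trans with (1 := H1). apply exp_le_compat, Ropp_le_contravar.
      pose proof (scaled_modulus_bounds a m). pose proof (inv_sqrt_S_bounds m).
      unfold Rdiv. rewrite (Rmult_assoc (PI ^ 2)), (Rmult_comm (/ _)), <- Rmult_assoc.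
      apply Rmult_le_compat_l.
      { apply Rmult_le_pos; apply pow2_ge_0. }
      pose proof (Hu m).
      apply Rinv_le_contravar; [apply pow_lt; auto|]. apply pow_incr; lra.
    + rewrite Rabs_R0; left; apply exp_pos.
  - apply ex_series_gauss. apply Rdiv_lt_0_compat; apply pow_lt; lra.
Qed.

(** [walk_ratio_lower] and [walk_ratio_upper] at k = l j, where k^2 / M tends to a j^2
    and k / M to 0; the terms with k <= M are at most exp (- k^2 / (2 M)). *)
Lemma walk_ratio_sum_lim a : 0 < a ->
  is_lim_seq (fun m => sum_f_R0 (fun j => walk_ratio (S m) (modulus a m * j)) (S m))
    (Series (fun j => exp (- (a * INR j ^ 2)))).
Proof.
  intros Ha. pose proof (sqrt_lt_R0 a Ha) as Hs.
  set (u := scaled_modulus a). set (e := fun m => / sqrt (INR (S m))).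
  assert (Hu : forall m, sqrt a <= u m) by (intros m; apply scaled_modulus_bounds).
  assert (He : forall m, 0 < e m <= 1) by (intros m; apply inv_sqrt_S_bounds).
  assert (Hul : is_lim_seq u (sqrt a)) by apply scaled_modulus_lim.
  assert (Hel : is_lim_seq e 0) by apply inv_sqrt_S_lim.
  assert (Hl : forall m, INR (modulus a m) = u m / e m) by apply modulus_scaled.
  assert (HM : forall m, INR (S m) = / e m ^ 2) by apply INR_S_inv_sqrt.
  assert (Hl1 : forall m, (1 <= modulus a m)%nat) by (intros m; unfold modulus; lia).
  assert (Hup : forall m j, (modulus a m * j <= S m)%nat ->
    walk_ratio (S m) (modulus a m * j) <= exp (- (u m ^ 2 * INR j ^ 2 / (1 + u m * INR j * e m)))).
  { intros m j Hj.
    eapply Rle_trans; [apply (walk_ratio_upper (S m) (modulus a m * j)); lia|].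
    right; do 2 f_equal. rewrite mult_INR, Hl, HM.
    pose proof (He m); pose proof (Hu m); pose proof (pos_INR j).
    assert (0 <= u m * INR j * e m) by (apply Rmult_le_pos; [apply Rmult_le_pos|]; lra).
    field; repeat split; lra. }
  assert (Hlo : forall m j, (modulus a m * j <= S m)%nat ->
    exp (- (u m ^ 2 * INR j ^ 2 / (1 - u m * INR j * e m + e m ^ 2)))
      <= walk_ratio (S m) (modulus a m * j)).
  { intros m j Hj.
    eapply Rle_trans; [|apply (walk_ratio_lower (S m) (modulus a m * j)); lia].
    right; do 2 f_equal. apply le_INR in Hj. rewrite mult_INR, Hl, HM in *.
    pose proof (He m) as Hem.
    assert (u m * INR j * e m <= 1).
    { apply (Rmult_le_reg_r (/ e m ^ 2)); [apply Rinv_0_lt_compat, pow_lt; lra|].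
      rewrite Rmult_1_l. apply Rle_trans with (2 := Hj). right; field; lra. }
    assert (0 < e m ^ 2) by (apply pow_lt; lra).
    field; repeat split; lra. }
  assert (E : forall m, sum_f_R0 (fun j => walk_ratio (S m) (modulus a m * j)) (S m) =
     Series (fun j => if Nat.leb j (S m) then walk_ratio (S m) (modulus a m * j) else 0)).
  { intros m. now rewrite Series_truncated. }
  apply (is_lim_seq_ext _ _ _ (fun m => eq_sym (E m))).
  apply Series_dominated with (M := fun v => exp (- (a / 2 * INR v ^ 2))).
  - intros j.
    assert (Hue : is_lim_seq (fun m => u m * INR j * e m) 0).
    { replace (Finite 0) with (Finite (sqrt a * INR j * 0)) by (f_equal; ring).
      apply is_lim_seq_mult'; auto. apply is_lim_seq_mult'; auto. apply is_lim_seq_const. }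
    assert (Hee : is_lim_seq (fun m => e m ^ 2) 0).
    { replace (Finite 0) with (Finite (0 * (0 * 1))) by (f_equal; ring).
      cbn [pow]; repeat apply is_lim_seq_mult'; auto. apply is_lim_seq_const. }
    assert (Huu : is_lim_seq (fun m => u m ^ 2 * INR j ^ 2) (a * INR j ^ 2)).
    { rewrite <- (sqrt_sqrt a) at 1 by lra.
      apply is_lim_seq_mult'; [|apply is_lim_seq_const].
      apply is_lim_seq_ext with (u := fun m => u m * u m); [intros; ring|].
      now apply is_lim_seq_mult'. }
    assert (Hev : eventually (fun m => (modulus a m * j <= S m)%nat)).
    { generalize (eventually_lt _ 0 1 Hue ltac:(lra)). apply filter_imp; intros m Hm.
      apply INR_le. rewrite mult_INR, Hl, HM. pose proof (He m).
      assert (0 < / e m ^ 2) by (apply Rinv_0_lt_compat, pow_lt; lra).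
      replace (u m / e m * INR j) with (u m * INR j * e m * / e m ^ 2) by (field; lra).
      nra. }
    apply (is_lim_seq_le_le_loc
      (fun m => exp (- (u m ^ 2 * INR j ^ 2 / (1 - u m * INR j * e m + e m ^ 2)))) _
      (fun m => exp (- (u m ^ 2 * INR j ^ 2 / (1 + u m * INR j * e m))))).
    + revert Hev; apply filter_imp; intros m Hm.
      destruct (Nat.leb_spec j (S m)); [split; auto|]. pose proof (Hl1 m); nia.
    + apply exp_opp_lim.
      replace (a * INR j ^ 2) with
        (a * INR j ^ 2 / (1 - 0 + 0)) by field.
      apply is_lim_seq_div'; auto; [|lra].
      apply is_lim_seq_plus'; auto. apply is_lim_seq_minus'; auto. apply is_lim_seq_const.
    + apply exp_opp_lim.
      replace (a * INR j ^ 2) with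
        (a * INR j ^ 2 / (1 + 0)) by field.
      apply is_lim_seq_div'; auto; [|lra].
      apply is_lim_seq_plus'; auto. apply is_lim_seq_const.
  - intros m j. destruct (Nat.leb_spec j (S m)) as [Hj|_].
    + rewrite Rabs_pos_eq by apply walk_ratio_ge0.
      destruct (Nat.le_gt_cases (modulus a m * j) (S m)) as [Hm|Hm].
      * eapply Rle_trans; [apply (walk_ratio_upper (S m) (modulus a m * j)); lia|].
        apply exp_le_compat, Ropp_le_contravar.
        apply le_INR in Hm. rewrite mult_INR in *.
        pose proof (lt_0_INR (S m) ltac:(lia)).
        pose proof (pos_INR j). pose proof (pos_INR (modulus a m)).
        apply Rle_trans with ((INR (modulus a m) * INR j) ^ 2 / (2 * INR (S m))).
        -- rewrite Hl, HM. pose proof (He m). pose proof (Hu m).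
           replace ((u m / e m * INR j) ^ 2 / (2 * / e m ^ 2)) with (u m ^ 2 / 2 * INR j ^ 2)
             by (field; lra).
           apply Rmult_le_compat_r; [apply pow2_ge_0|].
           rewrite <- (sqrt_sqrt a) at 1 by lra. nra.
        -- apply Rmult_le_compat_l; [apply pow2_ge_0|].
           apply Rinv_le_contravar; [|lra].
           assert (0 <= INR (modulus a m) * INR j) by (apply Rmult_le_pos; lra). lra.
      * rewrite walk_ratio_zero by auto. left; apply exp_pos.
    + rewrite Rabs_R0; left; apply exp_pos.
  - apply ex_series_gauss; lra.
Qed.

(** The sum over all integers n of exp (- pi n^2 t). *)
Definition theta (t : R) : R := 2 * Series (fun n => exp (- (PI * t * INR n ^ 2))) - 1.

Lemma theta_ge_1 t : 0 < t -> 1 <= theta t.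
Proof.
  intros Ht; unfold theta. pose proof PI_RGT_0.
  assert (ex : ex_series (fun n => exp (- (PI * t * INR n ^ 2))))
    by (apply ex_series_gauss; nra).
  rewrite Series_incr_1 by auto.
  replace (exp (- (PI * t * INR 0 ^ 2))) with 1.
  2: { rewrite <- exp_0; f_equal. simpl; ring. }
  enough (0 <= Series (fun k => exp (- (PI * t * INR (S k) ^ 2)))) by lra.
  apply (Rle_trans _ (Series (fun _ => 0 * 0))).
  - rewrite Series_scal_l; lra.
  - apply Series_le; [|now apply ex_series_incr_1 in ex].
    intros n; split; [lra|]. rewrite Rmult_0_l; left; apply exp_pos.
Qed.

(** The left side does not involve [t]: comparing the limits for [t] and for 1
    yields the functional equation. *)
Lemma return_prob_lim t : 0 < t ->
  is_lim_seq (fun m => sqrt (INR (S m)) * walk_prob (S m) 0)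
    (theta (/ t) / (theta t * sqrt (PI * t))).
Proof.
  intros Ht. pose proof PI_RGT_0 as Hpi.
  assert (Ha : 0 < PI * t) by nra.
  pose proof (sqrt_lt_R0 _ Ha).
  pose proof (theta_ge_1 t Ht).
  set (A := fun m => 2 * sum_f_R0 (fun v => cos (PI * INR v / INR (modulus (PI * t) m)) ^ (2 * S m))
                (half_modulus (PI * t) m) - 1).
  set (B := fun m => 2 * sum_f_R0 (fun j => walk_ratio (S m) (modulus (PI * t) m * j)) (S m) - 1).
  assert (HA : is_lim_seq A (theta (/ t))).
  { unfold A, theta. apply is_lim_seq_minus'; [|apply is_lim_seq_const].
    apply is_lim_seq_mult'; [apply is_lim_seq_const|].
    rewrite (Series_ext _ (fun v => exp (- (PI ^ 2 / (PI * t) * INR v ^ 2)))).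
    - now apply cos_sum_lim.
    - intros n; do 2 f_equal. field; lra. }
  assert (HB : is_lim_seq B (theta t)).
  { unfold B, theta. apply is_lim_seq_minus'; [|apply is_lim_seq_const].
    apply is_lim_seq_mult'; [apply is_lim_seq_const|]. now apply walk_ratio_sum_lim. }
  assert (HB1 : forall m, 1 <= B m).
  { intros m; unfold B.
    assert (1 <= sum_f_R0 (fun j => walk_ratio (S m) (modulus (PI * t) m * j)) (S m)); [|lra].
    rewrite decomp_sum by lia. rewrite Nat.mul_0_r. cbn [walk_ratio].
    assert (0 <= sum_f_R0 (fun i => walk_ratio (S m) (modulus (PI * t) m * S i)) (Init.Nat.pred (S m))); [|lra].
    apply cond_pos_sum; intros; apply walk_ratio_ge0. }
  apply is_lim_seq_ext with (u := fun m => A m / (B m * scaled_modulus (PI * t) m)).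
  - intros m. unfold A. unfold modulus at 1. rewrite finite_theta.
    fold (modulus (PI * t) m). fold (B m).
    rewrite modulus_scaled. pose proof (sqrt_S_pos m). pose proof (HB1 m).
    pose proof (scaled_modulus_bounds (PI * t) m).
    field. lra.
  - apply is_lim_seq_div'; auto; [|nra].
    apply is_lim_seq_mult'; auto. apply scaled_modulus_lim.
Qed.

Theorem theta_functional_equation t : 0 < t -> theta (/ t) = sqrt t * theta t.
Proof.
  intros Ht. pose proof PI_RGT_0.
  pose proof (is_lim_seq_unique _ _ (return_prob_lim t Ht)) as H1.
  pose proof (is_lim_seq_unique _ _ (return_prob_lim 1 Rlt_0_1)) as H2.
  rewrite H1 in H2; injection H2 as H2.
  pose proof (theta_ge_1 t Ht). pose proof (theta_ge_1 1 Rlt_0_1).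
  rewrite Rinv_1, Rmult_1_r, sqrt_mult in H2 by lra.
  pose proof (sqrt_lt_R0 _ Ht). pose proof (sqrt_lt_R0 _ H).
  transitivity (theta (/ t) / (theta t * (sqrt PI * sqrt t)) * (theta t * sqrt PI * sqrt t)).
  - field; lra.
  - rewrite H2; field; lra.
Qed.

(** * Derivatives from quadratic remainder bounds *)

(** Used for sums of series of real functions and for integrals depending on a complex
    parameter; the remainder can be estimated under the sum or the integral. *)
Lemma is_derive_quadratic {K : AbsRing} {V : NormedModule K} (f : K -> V) (x : K)
  (l : V) (M : R) :
  locally x (fun y => norm (minus (minus (f y) (f x)) (scal (minus y x) l))
                        <= M * norm (minus y x) ^ 2) ->
  is_derive f x l.
Proof.
  intros H; split; [apply is_linear_scal_l|].
  intros x0 Hx0.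
  apply (is_filter_lim_locally_unique (V := AbsRing_NormedModule K) x x0) in Hx0; subst x0.
  intros eps.
  assert (Hd : 0 < eps / (Rabs M + 1)).
  { apply Rdiv_lt_0_compat; [apply cond_pos|]. pose proof (Rabs_pos M); lra. }
  assert (H1 : locally x (fun y => norm (minus y x : AbsRing_NormedModule K) < eps / (Rabs M + 1))).
  { apply (locally_le_locally_norm (V := AbsRing_NormedModule K) x).
    exists (mkposreal _ Hd); intros y Hy; exact Hy. }
  generalize (filter_and _ _ H H1); apply filter_imp; intros y [H2 H3].
  apply Rle_trans with (1 := H2).
  assert (0 <= norm (minus y x)) by apply norm_ge_0.
  assert (M * norm (minus y x) <= eps).
  { pose proof (Rle_abs M). pose proof (Rabs_pos M).
    apply Rle_trans with ((Rabs M + 1) * (eps / (Rabs M + 1))); [nra|].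
    right; field; lra. }
  replace (M * norm (minus y x) ^ 2) with (M * norm (minus y x) * norm (minus y x)) by ring.
  now apply Rmult_le_compat_r.
Qed.

Lemma increment_bound (f df : R -> R) (x y M : R) :
  (forall z, is_derive f z (df z)) ->
  (forall z, Rabs (z - x) <= Rabs (y - x) -> Rabs (df z) <= M) ->
  Rabs (f y - f x) <= M * Rabs (y - x).
Proof.
  intros Hf HM.
  destruct (MVT_gen f x y df) as [c [Hc E]].
  - intros; apply Hf.
  - intros z _. apply derivable_continuous_pt. exists (df z). now apply is_derive_Reals.
  - rewrite E, Rabs_mult. apply Rmult_le_compat_r; [apply Rabs_pos|].
    apply HM. unfold Rmin, Rmax in Hc. destruct (Rle_dec x y).
    + rewrite !Rabs_pos_eq; lra.
    + rewrite !Rabs_left1; lra.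
Qed.

Lemma taylor_bound (f df ddf : R -> R) (x y M : R) :
  (forall z, is_derive f z (df z)) ->
  (forall z, is_derive df z (ddf z)) ->
  (forall z, Rabs (z - x) <= Rabs (y - x) -> Rabs (ddf z) <= M) ->
  Rabs (f y - f x - (y - x) * df x) <= M * Rabs (y - x) ^ 2.
Proof.
  intros Hf Hdf HM.
  replace (f y - f x - (y - x) * df x) with
    ((f y - y * df x) - (f x - x * df x)) by ring.
  replace (M * Rabs (y - x) ^ 2) with (M * Rabs (y - x) * Rabs (y - x)) by ring.
  apply (increment_bound (fun z => f z - z * df x) (fun z => df z - df x)).
  - intros z. apply (is_derive_minus f (fun z => z * df x)); auto.
    auto_derive; [trivial|ring].
  - intros z Hz. apply Rle_trans with (M * Rabs (z - x)).
    + apply (increment_bound df ddf); auto.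
      intros w Hw; apply HM; lra.
    + apply Rmult_le_compat_l; auto.
      apply Rle_trans with (2 := HM x ltac:(rewrite Rminus_diag, Rabs_R0; apply Rabs_pos)).
      apply Rabs_pos.
Qed.

Lemma is_derive_Series (u du ddu : nat -> R -> R) (M : nat -> R) (x : R) :
  (forall n z, is_derive (u n) z (du n z)) ->
  (forall n z, is_derive (du n) z (ddu n z)) ->
  (forall n z, Rabs (z - x) <= 1 -> Rabs (ddu n z) <= M n) ->
  ex_series M ->
  (forall z, ex_series (fun n => u n z)) ->
  ex_series (fun n => du n x) ->
  is_derive (fun z => Series (fun n => u n z)) x (Series (fun n => du n x)).
Proof.
  intros Hu Hdu HM eM eu edu.
  apply (is_derive_quadratic (V := R_NormedModule) _ _ _ (Series M)).
  exists (mkposreal 1 Rlt_0_1); intros y Hy.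
  change (Rabs (y - x) < 1) in Hy.
  change (Rabs ((Series (fun n => u n y) - Series (fun n => u n x)) -
    (y - x) * Series (fun n => du n x)) <= Series M * Rabs (y - x) ^ 2).
  rewrite <- Series_minus, <- Series_scal_l, <- Series_minus, <- Series_scal_r; auto.
  2: now apply (ex_series_minus (fun n => u n y) (fun n => u n x)).
  2: now apply (ex_series_scal (V := R_NormedModule) (y - x) (fun n => du n x)).
  assert (T : forall n, Rabs (u n y - u n x - (y - x) * du n x) <= M n * Rabs (y - x) ^ 2).
  { intros n. apply (taylor_bound (u n) (du n) (ddu n)); auto.
    intros z Hz; apply HM; lra. }
  assert (eM2 : ex_series (fun n => M n * Rabs (y - x) ^ 2)) by now apply ex_series_scal_r.
  apply Rle_trans with (Series (fun n => Rabs (u n y - u n x - (y - x) * du n x))).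
  - apply Series_Rabs. apply (ex_series_dominated _ _ (fun n => Rle_trans _ _ _ (Req_le _ _ (Rabs_Rabsolu _)) (T n)) eM2).
  - apply Series_le; auto. intros n; split; auto. apply Rabs_pos.
Qed.

(** * Delta4 in logarithmic coordinates *)

(** An even function carried together with its derivatives, all of at most exponential
    growth, so that each of them can be integrated against a Gaussian. *)
Definition even_tower (H : nat -> R -> R) : Prop :=
  (forall k x, is_derive (H k) x (H (S k) x)) /\
  (forall k, exists M, forall x, Rabs (H k x) <= M * exp (Rabs x)) /\
  (forall x, H 0%nat (- x) = H 0%nat x).

Lemma even_tower_parity H : even_tower H ->
  (forall x, H 1%nat (- x) = - H 1%nat x) /\ (forall x, H 2%nat (- x) = H 2%nat x).
Proof.
  intros [Hd [_ He]].
  assert (H1 : forall x, H 1%nat (- x) = - H 1%nat x).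
  { intros x.
    assert (D : is_derive (fun y => H 0%nat (- y)) x (- H 1%nat (- x))).
    { replace (- H 1%nat (- x)) with (scal (-1) (H 1%nat (- x)))
        by (unfold scal; simpl; unfold mult; simpl; ring).
      apply (is_derive_comp (H 0%nat) Ropp); [apply Hd|].
      auto_derive; auto. }
    apply (is_derive_ext _ (H 0%nat)) in D; [|exact He].
    apply is_derive_unique in D. rewrite (is_derive_unique _ _ _ (Hd 0%nat x)) in D. lra. }
  split; auto. intros x.
  assert (D : is_derive (fun y => - H 1%nat (- y)) x (H 2%nat (- x))).
  { replace (H 2%nat (- x)) with (- scal (-1) (H 2%nat (- x)))
      by (unfold scal; simpl; unfold mult; simpl; ring).
    apply (is_derive_opp (fun y => H 1%nat (- y))).
    apply (is_derive_comp (H 1%nat) Ropp); [apply Hd|].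
    auto_derive; auto. }
  apply (is_derive_ext _ (H 1%nat)) in D.
  - apply is_derive_unique in D. rewrite (is_derive_unique _ _ _ (Hd 1%nat x)) in D. lra.
  - intros t. rewrite (H1 t). apply (Ropp_involutive (H 1%nat t)).
Qed.

(** The derivatives of 16 h'' - h. *)
Definition log_Delta4 (H : nat -> R -> R) (k : nat) (x : R) : R := 16 * H (k + 2)%nat x - H k x.

Lemma even_tower_log_Delta4 H : even_tower H -> even_tower (log_Delta4 H).
Proof.
  intros HT. destruct (even_tower_parity H HT) as [_ H2]. destruct HT as [Hd [Hb He]].
  split; [|split].
  - intros k x; unfold log_Delta4.
    apply (is_derive_minus (fun x => 16 * H (k + 2)%nat x)); [|apply Hd].
    apply (is_derive_scal (H (k + 2)%nat)), Hd.
  - intros k. destruct (Hb k) as [M HM], (Hb (k + 2)%nat) as [N HN].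
    exists (16 * N + M); intros x. unfold log_Delta4.
    specialize (HM x); specialize (HN x).
    apply Rabs_le. apply Rabs_le_between in HM, HN. lra.
  - intros x; unfold log_Delta4. simpl. now rewrite H2, He.
Qed.

Definition represents (psi : R -> R) (c : R) (H : nat -> R -> R) : Prop :=
  forall t, 0 < t -> psi t = exp (- (ln t / 4)) * H 0%nat (ln t) + c.

Lemma locally_pos t : 0 < t -> locally t (fun s => 0 < s).
Proof. intros Ht. now apply (open_gt 0). Qed.

(** If p x = exp (- x / 4) h x, the derivatives of p (ln t) are p' (ln t) / t and
    (p'' - p') (ln t) / t^2, so Delta4 gives (16 p'' + 8 p') (ln t), and
    16 p'' + 8 p' = exp (- x / 4) (16 h'' - h). *)
Lemma Delta4_represents psi c H :
  even_tower H -> represents psi c H -> represents (Delta4 psi) 0 (log_Delta4 H).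
Proof.
  intros [Hd _] Hr t Ht.
  assert (HD : forall k x, Derive (fun y => H k y) x = H (S k) x)
    by (intros k x; apply is_derive_unique, Hd).
  set (D1 := fun t => exp (- (ln t / 4)) * (H 1%nat (ln t) - H 0%nat (ln t) / 4) / t).
  assert (E1 : forall t, 0 < t -> Derive psi t = D1 t).
  { intros s Hs.
    rewrite (Derive_ext_loc psi (fun t => exp (- (ln t / 4)) * H 0%nat (ln t) + c)).
    - apply is_derive_unique. auto_derive.
      + repeat split; auto. now exists (H 1%nat (ln s)).
      + rewrite HD. unfold D1, Rdiv. field; lra.
    - generalize (locally_pos s Hs); apply filter_imp; intros r Hrr; now apply Hr. }
  assert (E2 : Derive_n psi 2 t = exp (- (ln t / 4)) *
    (H 2%nat (ln t) - 3 / 2 * H 1%nat (ln t) + 5 / 16 * H 0%nat (ln t)) / t ^ 2).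
  { cbn [Derive_n].
    change (Derive (fun x => Derive psi x) t = exp (- (ln t / 4)) *
      (H 2%nat (ln t) - 3 / 2 * H 1%nat (ln t) + 5 / 16 * H 0%nat (ln t)) / t ^ 2).
    rewrite (Derive_ext_loc _ D1).
    - apply is_derive_unique. unfold D1. auto_derive.
      + repeat split; auto; try lra; [now exists (H 2%nat (ln t))|now exists (H 1%nat (ln t))].
      + rewrite !HD. unfold Rdiv. field; lra.
    - generalize (locally_pos t Ht); apply filter_imp; apply E1. }
  unfold Delta4. rewrite E2, E1 by auto. unfold D1, log_Delta4. simpl (0 + 2)%nat. field. lra.
Qed.

Lemma iter_Delta4_represents psi c H n :
  even_tower H -> represents psi c H ->
  even_tower (Nat.iter (n + 1) log_Delta4 H) /\
  represents (Nat.iter (n + 1) Delta4 psi) 0 (Nat.iter (n + 1) log_Delta4 H).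
Proof.
  intros HT HR; induction n as [|n [IH1 IH2]]; simpl.
  - split; [now apply even_tower_log_Delta4|]. now apply (Delta4_represents _ c).
  - split; [now apply even_tower_log_Delta4|]. now apply (Delta4_represents _ 0).
Qed.

(** * The theta function in logarithmic coordinates *)

(** The k-th derivative of y |-> exp ((j + 1/4) y - exp y).  A derivative raises [j]
    by at most one, which makes the recursion on [k] close up. *)
Fixpoint theta_term (k j : nat) (y : R) : R :=
  match k with
  | O => exp ((INR j + 1 / 4) * y - exp y)
  | S k => (INR j + 1 / 4) * theta_term k j y - theta_term k (S j) y
  end.

Lemma theta_term_derive k j y : is_derive (theta_term k j) y (theta_term (S k) j y).
Proof.
  revert j y; induction k as [|k IH]; intros j y.
  - cbn [theta_term]. rewrite S_INR. auto_derive; [trivial|].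
    replace ((INR j + 1 + 1 / 4) * y - exp y) with (((INR j + 1 / 4) * y - exp y) + y) by ring.
    rewrite (exp_plus (_ - _)). unfold Rminus. ring.
  - apply (is_derive_minus (fun y => (INR j + 1 / 4) * theta_term k j y)); [|apply IH].
    apply (is_derive_scal (theta_term k j)), IH.
Qed.

Lemma pow_le_exp n w : 0 <= w -> w ^ n <= INR n ^ n * exp w.
Proof.
  intros Hw. destruct n as [|n].
  - simpl. pose proof (exp_ineq1_le w). lra.
  - pose proof (lt_0_INR (S n) ltac:(lia)) as Hn.
    replace w with (INR (S n) * (w / INR (S n))) at 1 by (field; lra).
    rewrite Rpow_mult_distr. apply Rmult_le_compat_l; [apply pow_le; lra|].
    assert (0 <= w / INR (S n)) by (apply Rmult_le_pos; [|left; apply Rinv_0_lt_compat]; lra).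
    replace w with (INR (S n) * (w / INR (S n))) at 2 by (field; lra).
    rewrite <- exp_pow. apply pow_incr. split; auto.
    pose proof (exp_ineq1_le (w / INR (S n))); lra.
Qed.

(** (exp y)^(j+1) is at most a constant times exp (exp y). *)
Lemma theta_term_bound k j : exists M, forall y, Rabs (theta_term k j y) <= M * exp (- (3 / 4 * y)).
Proof.
  revert j; induction k as [|k IH]; intros j.
  - exists (INR (S j) ^ S j); intros y. cbn [theta_term].
    rewrite Rabs_pos_eq by (left; apply exp_pos).
    replace ((INR j + 1 / 4) * y - exp y) with (INR (S j) * y + - (3 / 4 * y) + - exp y)
      by (rewrite S_INR; field).
    rewrite !exp_plus, <- exp_pow, (exp_Ropp (exp y)).
    pose proof (pow_le_exp (S j) (exp y) (Rlt_le _ _ (exp_pos y))) as P.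
    pose proof (exp_pos (exp y)). pose proof (exp_pos (- (3 / 4 * y))).
    apply (Rmult_le_reg_r (exp (exp y))); auto.
    rewrite Rmult_assoc, Rinv_l, Rmult_1_r by lra. nra.
  - destruct (IH j) as [M HM], (IH (S j)) as [N HN].
    exists ((INR j + 1 / 4) * M + N); intros y. cbn [theta_term].
    specialize (HM y); specialize (HN y). pose proof (pos_INR j).
    eapply Rle_trans; [apply Rabs_triang|].
    rewrite Rabs_Ropp, Rabs_mult, (Rabs_pos_eq (INR j + 1 / 4)) by lra. nra.
Qed.

Definition log_square (n : nat) : R := ln (PI * INR (S n) ^ 2).

(** The k-th derivative of x |-> exp (x / 4) theta (exp x) / 2.  The n-th term of Psi (exp x)
    is a translate of a single function: exp (x / 4 - pi (n+1)^2 exp x) is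
    exp (- a / 4) [theta_term 0 0] (x + a) with a = ln (pi (n+1)^2). *)
Definition theta_tower (k : nat) (x : R) : R :=
  1 / 2 * ((1 / 4) ^ k * exp (x / 4)) +
  Series (fun n => exp (- (log_square n / 4)) * theta_term k 0 (x + log_square n)).

Lemma log_square_pos n : 0 < PI * INR (S n) ^ 2.
Proof. apply Rmult_lt_0_compat; [apply PI_RGT_0|]. apply pow_lt, lt_0_INR; lia. Qed.

Lemma ex_series_inv_square : ex_series (fun n => exp (- log_square n)).
Proof.
  apply (ex_series_dominated _ (fun n => 2 * (/ INR (S n) - / INR (S (S n))))).
  - intros n. rewrite Rabs_pos_eq by (left; apply exp_pos).
    unfold log_square. rewrite exp_Ropp, exp_ln by apply log_square_pos.
    rewrite (S_INR (S n)). pose proof (lt_0_INR (S n) ltac:(lia)) as Hn.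
    assert (1 <= INR (S n)) by (rewrite S_INR; pose proof (pos_INR n); lra).
    replace (2 * (/ INR (S n) - / (INR (S n) + 1))) with
      (/ (INR (S n) * (INR (S n) + 1) / 2)) by (field; lra).
    apply Rinv_le_contravar; [nra|]. pose proof PI2_1. nra.
  - exists (2 * (1 - 0)). apply (is_series_scal 2 (fun n => / INR (S n) - / INR (S (S n)))).
    change (is_lim_seq (sum_n (fun n => / INR (S n) - / INR (S (S n)))) (1 - 0)).
    apply (is_lim_seq_ext (fun n => 1 - / INR (S (S n)))).
    + intros n; induction n as [|n IH].
      * rewrite sum_O. simpl INR at 2. lra.
      * rewrite sum_Sn, <- IH. unfold plus; cbn -[INR]. lra.
    + apply is_lim_seq_minus'; [apply is_lim_seq_const|].
      apply (is_lim_seq_inv _ p_infty); [|discriminate].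
      apply (is_lim_seq_incr_1 (fun n => INR (S n))).
      apply (is_lim_seq_incr_1 INR), is_lim_seq_INR.
Qed.

(** The decay of [theta_term] supplies the factor exp (- 3 a / 4), which together
    with exp (- a / 4) is summable. *)
Lemma scaled_term_bound k : exists M, 0 <= M /\ forall n x,
  Rabs (exp (- (log_square n / 4)) * theta_term k 0 (x + log_square n)) <= M * exp (- (3 / 4 * x)) * exp (- log_square n).
Proof.
  destruct (theta_term_bound k 0) as [M HM].
  exists M; split.
  - specialize (HM 0). rewrite Rmult_0_r, Ropp_0, exp_0 in HM.
    pose proof (Rabs_pos (theta_term k 0 0)); lra.
  - intros n x. rewrite Rabs_mult, Rabs_pos_eq by (left; apply exp_pos).
    specialize (HM (x + log_square n)).
    replace (exp (- log_square n)) with (exp (- (log_square n / 4)) * exp (- (3 / 4 * log_square n)))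
      by (rewrite <- exp_plus; f_equal; field).
    replace (M * exp (- (3 / 4 * x)) * (exp (- (log_square n / 4)) * exp (- (3 / 4 * log_square n))))
      with (exp (- (log_square n / 4)) * (M * exp (- (3 / 4 * (x + log_square n))))).
    + apply Rmult_le_compat_l; auto. left; apply exp_pos.
    + rewrite Rmult_plus_distr_l, Ropp_plus_distr, exp_plus. ring.
Qed.

Lemma ex_series_scaled_term k x :
  ex_series (fun n => exp (- (log_square n / 4)) * theta_term k 0 (x + log_square n)).
Proof.
  destruct (scaled_term_bound k) as [M [_ HM]].
  apply (ex_series_dominated _ (fun n => M * exp (- (3 / 4 * x)) * exp (- log_square n))); auto.
  apply (ex_series_scal (V := R_NormedModule)), ex_series_inv_square.
Qed.

Lemma theta_tower_derive k x : is_derive (theta_tower k) x (theta_tower (S k) x).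
Proof.
  unfold theta_tower.
  apply (is_derive_plus (fun x => 1 / 2 * ((1 / 4) ^ k * exp (x / 4)))).
  - auto_derive; [trivial|]. cbn [pow]. unfold Rdiv. ring.
  - destruct (scaled_term_bound (S (S k))) as [M [M0 HM]].
    assert (D : forall j n z, is_derive (fun x => exp (- (log_square n / 4)) * theta_term j 0 (x + log_square n)) z
       (exp (- (log_square n / 4)) * theta_term (S j) 0 (z + log_square n))).
    { intros j n z. apply (is_derive_scal (fun x => theta_term j 0 (x + log_square n))).
      replace (theta_term (S j) 0 (z + log_square n)) with (scal 1 (theta_term (S j) 0 (z + log_square n)))
        by apply (scal_one (theta_term (S j) 0 (z + log_square n) : R_NormedModule)).
      apply (is_derive_comp (theta_term j 0) (fun x => x + log_square n)).
      - apply theta_term_derive.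
      - auto_derive; auto. }
    apply (is_derive_Series (fun n x => exp (- (log_square n / 4)) * theta_term k 0 (x + log_square n))
      (fun n x => exp (- (log_square n / 4)) * theta_term (S k) 0 (x + log_square n))
      (fun n x => exp (- (log_square n / 4)) * theta_term (S (S k)) 0 (x + log_square n))
      (fun n => M * exp (- (3 / 4 * (x - 1))) * exp (- log_square n))); auto.
    + intros n z Hz. apply Rle_trans with (1 := HM n z).
      apply Rmult_le_compat_r; [left; apply exp_pos|].
      apply Rmult_le_compat_l; auto. apply exp_le_compat.
      apply Rabs_le_between in Hz; lra.
    + apply (ex_series_scal (V := R_NormedModule)), ex_series_inv_square.
    + intros z; apply ex_series_scaled_term.
    + apply ex_series_scaled_term.
Qed.

Lemma theta_tower_bound k : exists M, forall x, Rabs (theta_tower k x) <= M * exp (Rabs x).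
Proof.
  destruct (scaled_term_bound k) as [M [M0 HM]].
  exists (1 / 2 + M * Series (fun n => exp (- log_square n))); intros x.
  assert (S0 : 0 <= Series (fun n => exp (- log_square n))).
  { apply Rle_trans with (Series (fun _ => 0 * 0)); [rewrite Series_scal_l; lra|].
    apply Series_le; [|apply ex_series_inv_square].
    intros n; rewrite Rmult_0_l; split; [lra|left; apply exp_pos]. }
  unfold theta_tower. eapply Rle_trans; [apply Rabs_triang|].
  rewrite Rmult_plus_distr_r. pose proof (Rabs_pos x). pose proof (Rle_abs x).
  pose proof (Rle_abs (- x)) as Hx; rewrite Rabs_Ropp in Hx.
  apply Rplus_le_compat.
  - assert (0 <= (1 / 4) ^ k <= 1).
    { split; [apply pow_le; lra|].
      pose proof (pow_incr (1 / 4) 1 k ltac:(lra)) as Hp; now rewrite pow1 in Hp. }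
    pose proof (exp_pos (x / 4)).
    assert (exp (x / 4) <= exp (Rabs x)) by (apply exp_le_compat; lra).
    assert (0 <= (1 / 4) ^ k * exp (x / 4) <= 1 * exp (x / 4)).
    { split; [apply Rmult_le_pos|apply Rmult_le_compat_r]; lra. }
    rewrite Rabs_pos_eq; lra.
  - apply Rle_trans with (Series (fun n => M * exp (- (3 / 4 * x)) * exp (- log_square n))).
    + eapply Rle_trans; [apply Series_Rabs|apply Series_le].
      * apply (ex_series_dominated _ (fun n => M * exp (- (3 / 4 * x)) * exp (- log_square n))).
        -- intros n; rewrite Rabs_Rabsolu; apply HM.
        -- apply (ex_series_scal (V := R_NormedModule)), ex_series_inv_square.
      * intros n; split; [apply Rabs_pos|apply HM].
      * apply (ex_series_scal (V := R_NormedModule)), ex_series_inv_square.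
    + rewrite Series_scal_l.
      assert (exp (- (3 / 4 * x)) <= exp (Rabs x)) by (apply exp_le_compat; lra).
      assert (0 <= M * Series (fun n => exp (- log_square n))) by (apply Rmult_le_pos; auto).
      nra.
Qed.

Lemma theta_Psi t : 0 < t -> theta t = 1 + 2 * Psi t.
Proof.
  intros Ht. pose proof PI_RGT_0. unfold theta, Psi.
  rewrite Series_incr_1 by (apply ex_series_gauss; nra).
  replace (exp (- (PI * t * INR 0 ^ 2))) with 1.
  2: { rewrite <- exp_0; f_equal. simpl; ring. }
  rewrite (Series_ext _ (fun n => exp (- PI * INR (S n) ^ 2 * t))); [ring|].
  intros n; f_equal; ring.
Qed.

Lemma theta_tower_0 x : theta_tower 0 x = exp (x / 4) * (theta (exp x) / 2).
Proof.
  rewrite theta_Psi by apply exp_pos. unfold theta_tower, Psi.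
  replace (exp (x / 4) * ((1 + 2 * _) / 2)) with
    (1 / 2 * ((1 / 4) ^ 0 * exp (x / 4)) + exp (x / 4) * Series (fun n => exp (- PI * INR (S n) ^ 2 * exp x)))
    by (simpl; field).
  f_equal. rewrite <- Series_scal_l. apply Series_ext; intros n.
  cbn [theta_term]. rewrite <- !exp_plus. f_equal.
  rewrite exp_plus. unfold log_square at 3. rewrite exp_ln by apply log_square_pos.
  cbn [INR]. field.
Qed.

Lemma theta_even_tower : even_tower theta_tower.
Proof.
  split; [exact theta_tower_derive|split; [exact theta_tower_bound|]].
  intros x. rewrite !theta_tower_0, exp_Ropp, theta_functional_equation by apply exp_pos.
  assert (E : sqrt (exp x) = exp (x / 4) * exp (x / 4)).
  { rewrite <- exp_plus. apply sqrt_lem_1; try (left; apply exp_pos).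
    rewrite <- exp_plus. f_equal; field. }
  rewrite E. replace (- x / 4) with (- (x / 4)) by field. rewrite exp_Ropp.
  pose proof (exp_pos (x / 4)). field; lra.
Qed.

Lemma Psi_represented : represents Psi (- (1 / 2)) theta_tower.
Proof.
  intros t Ht. rewrite theta_tower_0, exp_ln, theta_Psi by auto.
  rewrite exp_Ropp. pose proof (exp_pos (ln t / 4)). field; lra.
Qed.

(** * Improper integrals over the line *)

Notation is_line_int f l := (is_RInt_gen f (Rbar_locally m_infty) (Rbar_locally p_infty) l).

Lemma is_line_int_antiderivative {V : CompleteNormedModule R_AbsRing} (F f : R -> V) (l0 l1 : V) :
  (forall x, is_derive F x (f x)) -> (forall x, continuous f x) ->
  filterlim F (Rbar_locally m_infty) (locally l0) ->
  filterlim F (Rbar_locally p_infty) (locally l1) ->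
  is_line_int f (minus l1 l0).
Proof.
  intros HF Hf H0 H1.
  apply (filterlimi_lim_ext (fun ab => minus (F (snd ab)) (F (fst ab)))).
  - intros [a b]; apply is_RInt_derive; auto.
  - apply (filterlim_comp_2 (G := locally l1) (H := locally (opp l0))
      (fun ab => F (snd ab)) (fun ab => opp (F (fst ab))) plus).
    + apply (filterlim_comp _ _ _ snd F _ (Rbar_locally p_infty)); [apply filterlim_snd|auto].
    + apply (filterlim_comp _ _ _ (fun ab => F (fst ab)) opp _ (locally l0)).
      * apply (filterlim_comp _ _ _ fst F _ (Rbar_locally m_infty)); [apply filterlim_fst|auto].
      * apply (filterlim_opp (V := CompleteNormedModule.NormedModule _ V) l0).
    + apply (filterlim_plus (V := CompleteNormedModule.NormedModule _ V) l1 (opp l0)).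
Qed.

Lemma atan_p_infty : filterlim atan (Rbar_locally p_infty) (locally (PI / 2)).
Proof.
  apply (filterlim_ext_loc (fun x => PI / 2 - atan (/ x))).
  - exists 0; intros x Hx. rewrite atan_inv by auto. ring.
  - apply (filterlim_comp _ _ _ Rinv (fun y => PI / 2 - atan y) _ (locally 0)).
    + apply (filterlim_Rbar_inv p_infty). discriminate.
    + replace (locally (PI / 2)) with (locally (PI / 2 - atan 0))
        by (rewrite atan_0, Rminus_0_r; reflexivity).
      apply (ex_derive_continuous (fun y => PI / 2 - atan y)).
      auto_derive; trivial.
Qed.

Lemma atan_m_infty : filterlim atan (Rbar_locally m_infty) (locally (- (PI / 2))).
Proof.
  apply (filterlim_ext (fun x => - atan (- x))).
  - intros x; rewrite atan_opp; ring.
  - apply (filterlim_comp _ _ _ (fun x => atan (- x)) Ropp _ (locally (PI / 2))).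
    + apply (filterlim_comp _ _ _ Ropp atan _ (Rbar_locally p_infty)).
      * apply (filterlim_Rbar_opp m_infty).
      * apply atan_p_infty.
    + apply (filterlim_Rbar_opp (PI / 2)).
Qed.

Lemma is_derive_atan' x : is_derive atan x (/ (1 + x ^ 2)).
Proof. apply is_derive_Reals, derivable_pt_lim_atan. Qed.

Lemma continuous_inv_1_sqr x : continuous (fun x => / (1 + x ^ 2)) x.
Proof.
  apply (ex_derive_continuous (fun x => / (1 + x ^ 2))).
  auto_derive. nra.
Qed.

Lemma is_line_int_cauchy_density K : is_line_int (fun x => K * / (1 + x ^ 2)) (K * PI).
Proof.
  replace (K * PI) with (scal K (minus (PI / 2) (- (PI / 2)))).
  2: { unfold scal, minus, plus, opp; simpl; unfold mult; simpl; field. }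
  apply (is_RInt_gen_scal (fun x => / (1 + x ^ 2)) K).
  apply (is_line_int_antiderivative (V := R_CompleteNormedModule) atan).
  - apply is_derive_atan'.
  - apply continuous_inv_1_sqr.
  - apply atan_m_infty.
  - apply atan_p_infty.
Qed.

(** The density 1 / (1 + x^2) has the explicit primitive atan. *)
Definition dominated {V : CompleteNormedModule R_AbsRing} (f : R -> V) (K : R) : Prop :=
  forall x, norm (f x) <= K * / (1 + x ^ 2).

Lemma norm_is_RInt_atan {V : CompleteNormedModule R_AbsRing} (f : R -> V) (K : R) a b l :
  dominated f K -> is_RInt f a b l -> norm l <= K * Rabs (atan b - atan a).
Proof.
  intros dom.
  assert (Hle : forall a b l, a <= b -> is_RInt f a b l -> norm l <= K * Rabs (atan b - atan a)).
  { clear a b l; intros a b l Hab Hl.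
    rewrite Rabs_pos_eq.
    2: { destruct Hab as [Hab|<-]; [|lra]. pose proof (atan_increasing a b Hab); lra. }
    apply (norm_RInt_le f (fun x => K * / (1 + x ^ 2)) a b l); auto.
    apply (is_RInt_scal (fun x => / (1 + x ^ 2)) a b K).
    apply (is_RInt_derive (V := R_CompleteNormedModule) atan).
    - intros; apply is_derive_atan'.
    - intros; apply continuous_inv_1_sqr. }
  intros Hl. destruct (Rle_dec a b) as [H|H]; [now apply Hle|].
  rewrite <- (opp_opp l), norm_opp, Rabs_minus_sym.
  apply Hle; [lra|]. now apply is_RInt_swap.
Qed.

Lemma minus_exchange {G : AbelianGroup} (p q u v : G) :
  plus p v = plus u q -> minus v u = minus q p.
Proof.
  intros E.
  apply (plus_reg_l p).
  change (plus p (plus v (opp u)) = plus p (plus q (opp p))).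
  rewrite plus_assoc, E, (plus_comm u q), <- plus_assoc, plus_opp_r, plus_zero_r.
  rewrite (plus_comm q), plus_assoc, plus_opp_r, plus_zero_l. reflexivity.
Qed.

(** Cauchy's criterion: two integrals differ by at most [K] times the variation of
    atan over the end pieces. *)
Lemma ex_line_int_dominated {V : CompleteNormedModule R_AbsRing} (f : R -> V) (K : R) :
  dominated f K -> (forall x, continuous f x) -> exists l, is_line_int f l.
Proof.
  intros dom Hc.
  assert (Hex : forall a b, ex_RInt f a b) by (intros; apply ex_RInt_continuous; auto).
  apply (filterlimi_locally_cauchy (U := CompleteNormedModule.CompleteSpace _ V)
    (F := filter_prod (Rbar_locally m_infty) (Rbar_locally p_infty))
    (fun ab => is_RInt f (fst ab) (snd ab))).
  - apply filter_forall; intros [a b]; split; [apply Hex|].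
    simpl; intros y1 y2 H1 H2. rewrite <- (is_RInt_unique _ _ _ _ H1). now apply is_RInt_unique.
  - intros eps.
    assert (HK : 0 <= K).
    { pose proof (Rle_trans _ _ _ (norm_ge_0 (f 0)) (dom 0)) as H.
      replace (/ (1 + 0 ^ 2)) with 1 in H by field. lra. }
    assert (He : 0 < eps / (4 * K + 1)).
    { apply Rdiv_lt_0_compat; [apply cond_pos|lra]. }
    exists (fun ab => Rabs (atan (fst ab) - - (PI / 2)) < eps / (4 * K + 1) /\
                      Rabs (atan (snd ab) - PI / 2) < eps / (4 * K + 1)).
    split.
    + econstructor.
      * apply (atan_m_infty (fun y => Rabs (y - - (PI / 2)) < eps / (4 * K + 1))).
        now exists (mkposreal _ He).
      * apply (atan_p_infty (fun y => Rabs (y - PI / 2) < eps / (4 * K + 1))).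
        now exists (mkposreal _ He).
      * simpl; auto.
    + intros [a b] [a' b'] [Ha Hb] [Ha' Hb'] u v Hu Hv. simpl in *.
      destruct (Hex a a') as [p Hp], (Hex b b') as [q Hq].
      assert (E : minus v u = minus q p).
      { apply minus_exchange.
        pose proof (is_RInt_Chasles _ _ _ _ _ _ Hp Hv) as H1.
        pose proof (is_RInt_Chasles _ _ _ _ _ _ Hu Hq) as H2.
        exact (eq_trans (eq_sym (is_RInt_unique _ _ _ _ H1)) (is_RInt_unique _ _ _ _ H2)). }
      apply (norm_compat1 (V := CompleteNormedModule.NormedModule _ V) u v).
      replace (norm _) with (norm (minus q p)) by (f_equal; symmetry; exact E).
      apply (norm_is_RInt_atan _ _ _ _ _ dom) in Hp, Hq.
      eapply Rle_lt_trans; [apply norm_triangle|]. rewrite norm_opp.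
      apply Rabs_def2 in Ha, Hb, Ha', Hb'.
      assert (Rabs (atan b' - atan b) <= 2 * (eps / (4 * K + 1))) by (apply Rabs_le; lra).
      assert (Rabs (atan a' - atan a) <= 2 * (eps / (4 * K + 1))) by (apply Rabs_le; lra).
      apply Rle_lt_trans with (4 * K * (eps / (4 * K + 1))); [nra|].
      apply Rlt_le_trans with ((4 * K + 1) * (eps / (4 * K + 1))); [lra|].
      right; field; lra.
Qed.

Lemma norm_line_int_dominated {V : CompleteNormedModule R_AbsRing} (f : R -> V) (K : R) l :
  dominated f K -> is_line_int f l -> norm l <= K * PI.
Proof.
  intros dom Hl.
  apply (RInt_gen_norm (Fa := Rbar_locally m_infty) (Fb := Rbar_locally p_infty)
    f (fun x => K * / (1 + x ^ 2)) l (K * PI)).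
  - econstructor.
    + exists 0; intros x Hx; exact Hx.
    + exists 0; intros x Hx; exact Hx.
    + simpl; intros; lra.
  - apply filter_forall; intros ab x _; apply dom.
  - exact Hl.
  - apply is_line_int_cauchy_density.
Qed.

Lemma dominated_vanishes {V : CompleteNormedModule R_AbsRing} (f : R -> V) (K : R) (F : (R -> Prop) -> Prop) (FF : Filter F) :
  dominated f K -> (forall M, 0 < M -> F (fun x => M < Rabs x)) -> filterlim f F (locally (zero : V)).
Proof.
  intros dom HF. apply filterlim_locally; intros eps.
  pose proof (cond_pos eps).
  assert (HM : 0 < Rabs K / eps + 1).
  { pose proof (Rabs_pos K). assert (0 <= Rabs K / eps) by (apply Rdiv_le_0_compat; lra). lra. }
  generalize (HF _ HM); apply filter_imp; intros x Hx.
  apply (norm_compat1 (V := CompleteNormedModule.NormedModule _ V) zero (f x)).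
  replace (norm _) with (norm (f x)) by (f_equal; symmetry; apply (minus_zero_r (f x))).
  apply Rle_lt_trans with (1 := dom x).
  pose proof (Rle_abs K). pose proof (Rabs_pos K).
  assert (Hx2 : Rabs K / eps < 1 + x ^ 2).
  { rewrite <- (pow2_abs x). assert (0 <= Rabs K / eps) by (apply Rdiv_le_0_compat; lra). nra. }
  apply (Rmult_lt_reg_r (1 + x ^ 2)); [nra|].
  rewrite Rmult_assoc, Rinv_l by nra.
  apply Rle_lt_trans with (eps * (Rabs K / eps)).
  - replace (eps * (Rabs K / eps)) with (Rabs K) by (field; lra). lra.
  - now apply Rmult_lt_compat_l.
Qed.

Lemma dominated_vanishes_m {V : CompleteNormedModule R_AbsRing} (f : R -> V) (K : R) :
  dominated f K -> filterlim f (Rbar_locally m_infty) (locally (zero : V)).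
Proof.
  intros dom; apply (dominated_vanishes f K); auto; [apply Rbar_locally_filter|].
  intros M HM; exists (- M); intros x Hx. rewrite Rabs_left; lra.
Qed.

Lemma dominated_vanishes_p {V : CompleteNormedModule R_AbsRing} (f : R -> V) (K : R) :
  dominated f K -> filterlim f (Rbar_locally p_infty) (locally (zero : V)).
Proof.
  intros dom; apply (dominated_vanishes f K); auto; [apply Rbar_locally_filter|].
  intros M HM; exists M; intros x Hx. rewrite Rabs_pos_eq; lra.
Qed.

Lemma opp_self {V : ModuleSpace R_Ring} (y : V) : y = opp y -> y = zero.
Proof.
  intros E.
  assert (E2 : scal (plus one one) y = zero).
  { rewrite scal_distr_r, !scal_one. rewrite E at 2.
    exact (plus_opp_r (G := ModuleSpace.AbelianGroup R_Ring V) y). }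
  rewrite <- (scal_one y).
  replace (one : R_Ring) with (mult (/ 2 : R_Ring) (plus one one)).
  - rewrite <- scal_assoc, E2. apply scal_zero_r.
  - unfold mult, one, plus; simpl; field.
Qed.

(** The integral over [-b, b] equals its opposite, and the symmetric intervals
    are enough to compute the limit. *)
Lemma is_line_int_odd {V : CompleteNormedModule R_AbsRing} (f : R -> V) (l : V) :
  (forall x, f (- x) = opp (f x)) -> is_line_int f l -> l = zero.
Proof.
  intros Hodd Hl.
  assert (H0 : forall b y, is_RInt f (- b) b y -> y = zero).
  { intros b y Hy.
    assert (H1 : is_RInt f b (- b) y).
    { apply (is_RInt_ext (fun x => opp (f (- x)))).
      - intros x _. rewrite Hodd. apply opp_opp.
      - apply (is_RInt_comp_opp f b (- b) y). rewrite (Ropp_involutive b). exact Hy. }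
    apply is_RInt_swap in H1.
    assert (E : y = opp y) by (rewrite <- (is_RInt_unique _ _ _ _ Hy) at 1; now apply is_RInt_unique).
    exact (opp_self y E). }
  apply eq_close. intros eps.
  apply filterlimi_locally with (eps := eps) in Hl.
  destruct Hl as [Q P [M HM] [N HN] H].
  set (b := Rmax (Rmax 0 (- M)) N + 1).
  assert (M > - b /\ N < b) as [b1 b2].
  { unfold b. pose proof (Rmax_l (Rmax 0 (- M)) N). pose proof (Rmax_r (Rmax 0 (- M)) N).
    pose proof (Rmax_r 0 (- M)). lra. }
  destruct (H (- b) b (HM _ b1) (HN _ b2)) as [y [Hy B]].
  simpl in Hy. rewrite (H0 _ _ Hy) in B. exact B.
Qed.

(** The substitution x = ln t. *)
Lemma is_RInt_gen_log {V : CompleteNormedModule R_AbsRing} (f : R -> V) (l : V) :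
  (forall x, continuous f x) -> is_line_int f l ->
  is_RInt_gen (fun t => scal (/ t) (f (ln t))) (at_right 0) (Rbar_locally p_infty) l.
Proof.
  intros Hc Hl P HP. destruct (Hl P HP) as [Q S HQ HS H].
  assert (HQ' : at_right 0 (fun x => Q (ln x))) by exact (is_lim_ln_0 Q HQ).
  assert (HS' : Rbar_locally p_infty (fun x => S (ln x))).
  { assert (L : filterlim ln (Rbar_locally p_infty) (Rbar_locally p_infty)) by apply is_lim_ln_p.
    exact (L S HS). }
  assert (H0 : at_right 0 (fun x => 0 < x)) by (exists (mkposreal 1 Rlt_0_1); auto).
  assert (H1 : Rbar_locally p_infty (fun x => 0 < x)) by (exists 0; auto).
  apply (Filter_prod _ _ _ (fun a => Q (ln a) /\ 0 < a) (fun b => S (ln b) /\ 0 < b)).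
  - exact (filter_and _ _ HQ' H0).
  - exact (filter_and _ _ HS' H1).
  - simpl. intros a b [Ha Pa] [Hb Pb].
    destruct (H _ _ Ha Hb) as [y [Hy Py]]. exists y; split; auto.
    simpl in *. rewrite <- (is_RInt_unique _ _ _ _ Hy).
    apply (is_RInt_comp f ln Rinv).
    + intros; apply Hc.
    + intros x Hx. assert (0 < x).
      { apply Rlt_le_trans with (2 := proj1 Hx). now apply Rmin_glb_lt. }
      split.
      * apply is_derive_Reals. now apply derivable_pt_lim_ln.
      * apply (ex_derive_continuous Rinv). auto_derive; lra.
Qed.

(** * Complex exponential and complex derivatives *)

Lemma Cexp_plus z w : Cexp (z + w)%C = (Cexp z * Cexp w)%C.
Proof.
  destruct z as [a b], w as [c d]. unfold Cexp, Cmult, Cplus, Re, Im; simpl.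
  rewrite exp_plus, cos_plus, sin_plus. f_equal; ring.
Qed.

Lemma Cexp_RtoC (x : R) : Cexp x = exp x.
Proof. unfold Cexp, RtoC; simpl. rewrite cos_0, sin_0. f_equal; ring. Qed.

Lemma Cmod_Cexp z : Cmod (Cexp z) = exp (Re z).
Proof.
  unfold Cmod, Cexp; cbn [fst snd].
  replace ((exp (Re z) * cos (Im z)) ^ 2 + (exp (Re z) * sin (Im z)) ^ 2)
    with (exp (Re z) ^ 2 * (Rsqr (sin (Im z)) + Rsqr (cos (Im z)))) by (unfold Rsqr; ring).
  rewrite sin2_cos2, Rmult_1_r. apply sqrt_pow2. left; apply exp_pos.
Qed.

Lemma Cmod_le_sum z : Cmod z <= Rabs (Re z) + Rabs (Im z).
Proof.
  replace z with (RtoC (Re z) + Ci * RtoC (Im z))%C at 1.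
  - eapply Rle_trans; [apply Cmod_triangle|].
    rewrite Cmod_mult, Cmod_Ci, !Cmod_R; lra.
  - destruct z; unfold Re, Im, Cplus, Cmult, RtoC, Ci; simpl; f_equal; ring.
Qed.

Lemma Rabs_Im_le z : Rabs (Im z) <= Cmod z.
Proof. eapply Rle_trans; [|apply Rmax_Cmod]. apply Rmax_r. Qed.

Lemma exp_taylor_real a : Rabs (exp a - 1 - a) <= a ^ 2 * exp (Rabs a).
Proof.
  pose proof (taylor_bound exp exp exp 0 a (exp (Rabs a))) as T.
  rewrite exp_0, Rminus_0_r, Rmult_1_r, pow2_abs, Rmult_comm in T.
  apply T; try (intros; apply is_derive_exp).
  intros z Hz. rewrite Rminus_0_r in Hz. rewrite Rabs_pos_eq by (left; apply exp_pos).
  apply exp_le_compat. pose proof (Rle_abs z); lra.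
Qed.

Lemma cos_taylor_real b : Rabs (cos b - 1) <= b ^ 2.
Proof.
  pose proof (taylor_bound cos (fun z => - sin z) (fun z => - cos z) 0 b 1) as T.
  rewrite cos_0, sin_0, Rminus_0_r, pow2_abs in T.
  replace (cos b - 1 - b * - 0) with (cos b - 1) in T by ring.
  rewrite Rmult_1_l in T. apply T; try (intros; auto_derive; [trivial|ring]).
  intros z _. apply Rabs_le. pose proof (COS_bound z); lra.
Qed.

Lemma sin_taylor_real b : Rabs (sin b - b) <= b ^ 2.
Proof.
  pose proof (taylor_bound sin cos (fun z => - sin z) 0 b 1) as T.
  rewrite cos_0, sin_0, Rminus_0_r, pow2_abs in T.
  replace (sin b - 0 - b * 1) with (sin b - b) in T by ring.
  rewrite Rmult_1_l in T. apply T; try (intros; auto_derive; [trivial|ring]).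
  intros z _. apply Rabs_le. pose proof (SIN_bound z); lra.
Qed.

Lemma exp_sub_1_real a : Rabs (exp a - 1) <= Rabs a * exp (Rabs a).
Proof.
  pose proof (increment_bound exp exp 0 a (exp (Rabs a))) as T.
  rewrite exp_0, Rminus_0_r, Rmult_comm in T.
  apply T; try (intros; apply is_derive_exp).
  intros z Hz. rewrite Rminus_0_r in Hz. rewrite Rabs_pos_eq by (left; apply exp_pos).
  apply exp_le_compat. pose proof (Rle_abs z); lra.
Qed.

Lemma Cexp_taylor z : Cmod (Cexp z - 1 - z)%C <= 5 * Cmod z ^ 2 * exp (Cmod z).
Proof.
  set (r := Cmod z).
  pose proof (re_le_Cmod z) as Ha; pose proof (Rabs_Im_le z) as Hb.
  fold r in Ha, Hb.
  assert (Hr : 0 <= r) by apply Cmod_ge_0.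
  clearbody r.
  destruct z as [a b]. unfold Re, Im in Ha, Hb; simpl in Ha, Hb.
  pose proof (Rabs_pos a); pose proof (Rabs_pos b).
  assert (Ha2 : a ^ 2 <= r ^ 2) by (rewrite <- pow2_abs; apply pow_incr; lra).
  assert (Hb2 : b ^ 2 <= r ^ 2) by (rewrite <- pow2_abs; apply pow_incr; lra).
  assert (Ee : exp (Rabs a) <= exp r) by now apply exp_le_compat.
  assert (E1 : 1 <= exp r) by (pose proof (exp_ineq1_le r); lra).
  assert (Ea : exp a <= exp r) by (apply exp_le_compat; pose proof (Rle_abs a); lra).
  pose proof (exp_pos a); pose proof (exp_pos (Rabs a)).
  pose proof (pow2_ge_0 a); pose proof (pow2_ge_0 b); pose proof (pow2_ge_0 r).
  assert (Hre : Rabs ((exp a - 1 - a) + exp a * (cos b - 1)) <= 2 * r ^ 2 * exp r).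
  { eapply Rle_trans; [apply Rabs_triang|].
    rewrite Rabs_mult, (Rabs_pos_eq (exp a)) by lra.
    assert (a ^ 2 * exp (Rabs a) <= r ^ 2 * exp r) by (apply Rmult_le_compat; lra).
    assert (exp a * Rabs (cos b - 1) <= exp r * r ^ 2).
    { apply Rmult_le_compat; try lra; [apply Rabs_pos|].
      pose proof (cos_taylor_real b); lra. }
    pose proof (exp_taylor_real a). lra. }
  assert (Him : Rabs (exp a * (sin b - b) + (exp a - 1) * b) <= 2 * r ^ 2 * exp r).
  { eapply Rle_trans; [apply Rabs_triang|].
    rewrite !Rabs_mult, (Rabs_pos_eq (exp a)) by lra.
    assert (exp a * Rabs (sin b - b) <= exp r * r ^ 2).
    { apply Rmult_le_compat; try lra; [apply Rabs_pos|].
      pose proof (sin_taylor_real b); lra. }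
    assert (Rabs (exp a - 1) * Rabs b <= Rabs a * exp (Rabs a) * Rabs b)
      by (apply Rmult_le_compat_r; [lra|apply exp_sub_1_real]).
    assert (Rabs a * Rabs b * exp (Rabs a) <= r * r * exp r).
    { apply Rmult_le_compat; try lra; [apply Rmult_le_pos; lra|].
      apply Rmult_le_compat; lra. }
    simpl; lra. }
  eapply Rle_trans; [apply Cmod_le_sum|].
  replace (Re (Cexp (a, b) - 1 - (a, b))%C) with ((exp a - 1 - a) + exp a * (cos b - 1))
    by (unfold Cexp, Cminus, Cplus, Copp, RtoC, Re, Im; simpl; ring).
  replace (Im (Cexp (a, b) - 1 - (a, b))%C) with (exp a * (sin b - b) + (exp a - 1) * b)
    by (unfold Cexp, Cminus, Cplus, Copp, RtoC, Re, Im; simpl; ring).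
  assert (0 <= r ^ 2 * exp r) by (apply Rmult_le_pos; lra). lra.
Qed.

(** Here C is a normed module over itself, and over R in [is_RCderive]; the two have
    different uniform structures, so transfer between them is a lemma. *)
Notation is_Cderive F z l :=
  (@is_derive C_AbsRing (AbsRing_NormedModule C_AbsRing) F z l).

Notation is_RCderive f x l := (@is_derive R_AbsRing C_R_NormedModule f x l).

Lemma is_Cderive_quadratic (F : C -> C) (z l : C) (M : R) :
  (forall h, Cmod h < 1 -> Cmod (F (z + h) - F z - h * l)%C <= M * Cmod h ^ 2) ->
  is_Cderive F z l.
Proof.
  intros H. apply (is_derive_quadratic _ _ _ M).
  exists (mkposreal 1 Rlt_0_1); intros y Hy.
  change (Cmod (y - z)%C < 1) in Hy.
  change (Cmod (F y - F z - (y - z) * l)%C <= M * Cmod (y - z)%C ^ 2).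
  replace (F y) with (F (z + (y - z))%C) by (f_equal; ring).
  now apply H.
Qed.

Lemma Cexp_is_Cderive z : is_Cderive Cexp z (Cexp z).
Proof.
  apply (is_Cderive_quadratic _ _ _ (exp (Re z) * (5 * exp 1))).
  intros h Hh. rewrite Cexp_plus.
  replace (Cexp z * Cexp h - Cexp z - h * Cexp z)%C with (Cexp z * (Cexp h - 1 - h))%C by ring.
  rewrite Cmod_mult, Cmod_Cexp, Rmult_assoc.
  apply Rmult_le_compat_l; [left; apply exp_pos|].
  apply Rle_trans with (1 := Cexp_taylor h).
  pose proof (pow2_ge_0 (Cmod h)).
  assert (exp (Cmod h) <= exp 1) by (apply exp_le_compat; lra). nra.
Qed.

Lemma is_Cderive_mult (F G : C -> C) (z a b : C) :
  is_Cderive F z a -> is_Cderive G z b ->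
  is_Cderive (fun z => F z * G z)%C z (a * G z + F z * b)%C.
Proof.
  intros HF HG. apply (is_derive_mult (K := C_AbsRing) F G z a b HF HG).
  apply Cmult_comm.
Qed.

Lemma is_Cderive_plus (F G : C -> C) (z a b : C) :
  is_Cderive F z a -> is_Cderive G z b ->
  is_Cderive (fun z => F z + G z)%C z (a + b)%C.
Proof. apply (is_derive_plus (K := C_AbsRing) (V := AbsRing_NormedModule C_AbsRing)). Qed.

Lemma is_Cderive_const (c z : C) : is_Cderive (fun _ => c) z (RtoC 0).
Proof. apply (is_derive_const (K := C_AbsRing) (V := AbsRing_NormedModule C_AbsRing)). Qed.

Lemma is_Cderive_id (z : C) : is_Cderive (fun z => z) z (RtoC 1).
Proof. apply (is_derive_id (K := C_AbsRing)). Qed.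

Lemma is_Cderive_comp (F G : C -> C) (z a b : C) :
  is_Cderive F (G z) a -> is_Cderive G z b -> is_Cderive (fun z => F (G z)) z (b * a)%C.
Proof. apply (is_derive_comp (K := C_AbsRing) (V := AbsRing_NormedModule C_AbsRing)). Qed.

Lemma is_Cderive_eq (F : C -> C) (z a b : C) : is_Cderive F z a -> a = b -> is_Cderive F z b.
Proof. now intros H <-. Qed.

Lemma is_Cderive_ext (F G : C -> C) (z a : C) : (forall z, F z = G z) -> is_Cderive F z a -> is_Cderive G z a.
Proof. intros H; now apply (is_derive_ext (V := AbsRing_NormedModule C_AbsRing)). Qed.

Lemma is_Cderive_affine (a b z : C) : is_Cderive (fun z => a * z + b)%C z a.
Proof.
  eapply is_Cderive_eq.
  - apply (is_Cderive_plus (fun z => a * z)%C (fun _ => b)); [|apply is_Cderive_const].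
    apply (is_Cderive_mult (fun _ => a) (fun z => z)); [apply is_Cderive_const|apply is_Cderive_id].
  - ring.
Qed.

Lemma scal_C (k : R) (z : C) : @scal R_AbsRing C_R_NormedModule k z = (RtoC k * z)%C.
Proof.
  destruct z. unfold scal; simpl; unfold prod_scal, scal, Cmult; simpl.
  unfold mult; simpl. f_equal; ring.
Qed.

Lemma is_linear_Cmult (l : C) :
  @is_linear R_AbsRing C_R_NormedModule C_R_NormedModule (fun z => l * z)%C.
Proof.
  split.
  - intros x y. apply Cmult_plus_distr_l.
  - intros k x. rewrite !scal_C. change (l * (RtoC k * x) = RtoC k * (l * x))%C. ring.
  - exists (Cmod l + 1); split; [pose proof (Cmod_ge_0 l); lra|].
    intros x. rewrite <- !Cmod_norm, Cmod_mult. pose proof (Cmod_ge_0 x); pose proof (Cmod_ge_0 l). nra.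
Qed.

(** [F] is also differentiable over the reals, with differential z |-> l z, and the
    chain rule over the reals applies. *)
Lemma is_RCderive_comp (F : C -> C) (g : R -> C) (x : R) (l dg : C) :
  is_Cderive F (g x) l -> is_RCderive g x dg ->
  is_RCderive (fun y => F (g y)) x (dg * l)%C.
Proof.
  intros HF Hg.
  assert (HF' : @filterdiff R_AbsRing C_R_NormedModule C_R_NormedModule F
    (locally (g x : C_R_NormedModule)) (fun z => l * z)%C).
  { split; [apply is_linear_Cmult|].
    intros y Hy eps. apply is_filter_lim_locally_unique in Hy.
    destruct HF as [_ HF].
    specialize (HF y). assert (Hy' : @is_filter_lim (AbsRing_UniformSpace C_AbsRing) (locally (g x : AbsRing_UniformSpace C_AbsRing)) y).
    { rewrite <- Hy. intros P HP; exact HP. }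
    specialize (HF Hy' eps).
    apply locally_C in HF. revert HF. apply filter_imp; intros z Hz.
    rewrite <- !Cmod_norm.
    change (Cmod ((F z - F y) - l * (z - y))%C <= eps * Cmod (z - y)%C).
    change (Cmod ((F z - F y) - (z - y) * l)%C <= eps * Cmod (z - y)%C) in Hz.
    now rewrite (Cmult_comm l). }
  pose proof (filterdiff_comp' (U := R_NormedModule) (V := C_R_NormedModule)
    (W := C_R_NormedModule) g F x _ _ Hg HF') as H.
  apply (filterdiff_ext_lin _ _ _ H).
  intros y. rewrite !scal_C. change (l * (RtoC y * dg) = RtoC y * (dg * l))%C. ring.
Qed.

Lemma is_RCderive_iff (f : R -> C) (x : R) (l : C) :
  is_RCderive f x l <->
  is_derive (fun y => Re (f y)) x (Re l) /\ is_derive (fun y => Im (f y)) x (Im l).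
Proof.
  split.
  - intros H; split.
    + apply (filterdiff_comp' (U := R_NormedModule) (V := C_R_NormedModule)
        (W := R_NormedModule) f Re x (fun y => scal y l) Re); auto.
      apply filterdiff_linear, (is_linear_fst (U := R_NormedModule) (V := R_NormedModule)).
    + apply (filterdiff_comp' (U := R_NormedModule) (V := C_R_NormedModule)
        (W := R_NormedModule) f Im x (fun y => scal y l) Im); auto.
      apply filterdiff_linear, (is_linear_snd (U := R_NormedModule) (V := R_NormedModule)).
  - intros [H1 H2].
    pose proof (is_derive_plus (V := C_R_NormedModule) _ _ _ _ _
      (is_derive_scal_l (V := C_R_NormedModule) _ _ _ (RtoC 1) H1)
      (is_derive_scal_l (V := C_R_NormedModule) _ _ _ Ci H2)) as H.
    assert (E : forall a b : R, plus (scal a (RtoC 1 : C_R_NormedModule)) (scal b (Ci : C_R_NormedModule)) = (a, b)).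
    { intros a b. unfold plus, scal; simpl. unfold prod_plus, prod_scal, plus, scal; simpl.
      unfold mult; simpl. f_equal; ring. }
    rewrite E in H. destruct l as [l1 l2]; unfold Re, Im in *; simpl in *.
    revert H. apply is_derive_ext. intros t. rewrite E. destruct (f t); reflexivity.
Qed.

Lemma is_RCderive_mult (f g : R -> C) (x : R) (a b : C) :
  is_RCderive f x a -> is_RCderive g x b ->
  is_RCderive (fun y => f y * g y)%C x (a * g x + f x * b)%C.
Proof.
  rewrite !is_RCderive_iff; intros [f1 f2] [g1 g2].
  assert (M : forall u v (u' v' : R), is_derive u x u' -> is_derive v x v' ->
    is_derive (fun y => u y * v y) x (u' * v x + u x * v')).
  { intros u v u' v' Hu Hv. apply (is_derive_mult u v x u' v' Hu Hv). apply Rmult_comm. }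
  split.
  - replace (Re (a * g x + f x * b)%C) with
      ((Re a * Re (g x) + Re (f x) * Re b) - (Im a * Im (g x) + Im (f x) * Im b))
      by (unfold Re, Im, Cplus, Cmult; simpl; ring).
    apply (is_derive_minus (fun y => Re (f y) * Re (g y)) (fun y => Im (f y) * Im (g y)));
      now apply M.
  - replace (Im (a * g x + f x * b)%C) with
      ((Re a * Im (g x) + Re (f x) * Im b) + (Im a * Re (g x) + Im (f x) * Re b))
      by (unfold Re, Im, Cplus, Cmult; simpl; ring).
    apply (is_derive_plus (fun y => Re (f y) * Im (g y)) (fun y => Im (f y) * Re (g y)));
      now apply M.
Qed.

Lemma is_RCderive_real (h : R -> R) (x l : R) : is_derive h x l -> is_RCderive (fun y => RtoC (h y)) x (RtoC l).
Proof.
  intros H; apply is_RCderive_iff; split; simpl; auto.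
  apply (is_derive_const (V := R_NormedModule)).
Qed.

Lemma is_RCderive_continuous (f : R -> C) (x : R) (l : C) : is_RCderive f x l -> continuous (f : R -> C_R_NormedModule) x.
Proof. intros H; apply (ex_derive_continuous (V := C_R_NormedModule)); now exists l. Qed.

(** * Convolution with a complex Gaussian *)

Definition gauss (rho z : C) : C := Cexp (- rho * (z * z))%C.

Lemma gauss_is_Cderive rho z : is_Cderive (gauss rho) z (- (2 * rho * z) * gauss rho z)%C.
Proof.
  eapply is_Cderive_eq.
  - apply (is_Cderive_comp Cexp (fun z => - rho * (z * z))%C); [apply Cexp_is_Cderive|].
    apply (is_Cderive_mult (fun _ => - rho)%C (fun z => z * z)%C); [apply is_Cderive_const|].
    apply (is_Cderive_mult (fun z => z) (fun z => z)); apply is_Cderive_id.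
  - unfold gauss. ring.
Qed.

Lemma one_plus_sqr_le x : 1 + x ^ 2 <= 4 * exp (Rabs x).
Proof.
  rewrite <- pow2_abs. pose proof (Rabs_pos x) as H. set (y := Rabs x) in *.
  replace y with (y / 2 + y / 2) at 2 by field. rewrite exp_plus.
  pose proof (exp_ineq1_le (y / 2)). nra.
Qed.

(** |gauss rho (x - c)| = exp (- r x^2 + O(1 + |x|)) with r = Re rho > 0; the square beats
    any multiple of |x|. *)
Lemma gauss_dominated rho c A : 0 < Re rho ->
  exists K, 0 <= K /\ forall x : R,
    Cmod (gauss rho (x - c)) * exp (A * Rabs x) <= K * / (1 + x ^ 2).
Proof.
  intros Hr. set (r := Re rho) in *.
  set (B := Cmod (2 * rho * c)%C). set (D := Cmod (rho * (c * c))%C).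
  exists (4 * exp (D + (A + B + 1) ^ 2 / (4 * r))). split.
  { pose proof (exp_pos (D + (A + B + 1) ^ 2 / (4 * r))); lra. }
  intros x. unfold gauss. rewrite Cmod_Cexp, <- exp_plus.
  assert (HRe : Re (- rho * ((x - c) * (x - c)))%C <= - (r * x ^ 2) + B * Rabs x + D).
  { replace (Re (- rho * ((x - c) * (x - c)))%C) with
      (- (r * x ^ 2) + Re (2 * rho * c)%C * x - Re (rho * (c * c))%C).
    - assert (Re (2 * rho * c)%C * x <= B * Rabs x).
      { apply Rle_trans with (1 := Rle_abs _). rewrite Rabs_mult.
        apply Rmult_le_compat_r; [apply Rabs_pos|apply re_le_Cmod]. }
      pose proof (re_le_Cmod (rho * (c * c))%C) as H2; fold D in H2.
      pose proof (Rle_abs (- Re (rho * (c * c))%C)) as H3; rewrite Rabs_Ropp in H3. lra.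
    - unfold r. destruct rho, c; unfold Re, Cplus, Cminus, Copp, Cmult, RtoC; simpl. ring. }
  apply (Rmult_le_reg_r (1 + x ^ 2)); [nra|].
  rewrite (Rmult_assoc (4 * _)), Rinv_l, Rmult_1_r by nra.
  pose proof (one_plus_sqr_le x) as H1.
  pose proof (exp_pos (Re (- rho * ((x - c) * (x - c)))%C + A * Rabs x)) as H2.
  apply Rle_trans with (exp (Re (- rho * ((x - c) * (x - c)))%C + A * Rabs x) * (4 * exp (Rabs x))).
  { apply Rmult_le_compat_l; lra. }
  replace (exp _ * (4 * exp (Rabs x))) with
    (4 * exp (Re (- rho * ((x - c) * (x - c)))%C + A * Rabs x + Rabs x))
    by (rewrite (exp_plus (_ + _)); ring).
  apply Rmult_le_compat_l; [lra|]. apply exp_le_compat.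
  (* completing the square *)
  enough (- (r * x ^ 2) + (A + B + 1) * Rabs x <= (A + B + 1) ^ 2 / (4 * r)) by lra.
  rewrite <- (pow2_abs x). set (y := Rabs x). set (q := A + B + 1).
  replace (q ^ 2 / (4 * r)) with (- (r * y ^ 2) + q * y + r * (y - q / (2 * r)) ^ 2)
    by (field; lra).
  pose proof (pow2_ge_0 (y - q / (2 * r))). nra.
Qed.

(** gauss (v - z) = gauss v * exp zeta with zeta = 2 rho v z - rho z^2, and
    |zeta| <= |z| b, b = |rho| (2 |v| + 1), for |z| < 1. *)
Lemma gauss_taylor rho v z : Cmod z < 1 ->
  Cmod (gauss rho (v - z) - gauss rho v - z * (2 * rho * v * gauss rho v))%C
    <= (40 + Cmod rho) * Cmod z ^ 2 *
       (Cmod (gauss rho v) * exp (2 * (Cmod rho * (2 * Cmod v + 1)))).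
Proof.
  intros Hz. set (zeta := (2 * rho * v * z - rho * (z * z))%C).
  set (b := Cmod rho * (2 * Cmod v + 1)).
  assert (E : gauss rho (v - z) = (gauss rho v * Cexp zeta)%C).
  { unfold gauss. rewrite <- Cexp_plus. f_equal. unfold zeta; ring. }
  rewrite E.
  replace (gauss rho v * Cexp zeta - gauss rho v - z * (2 * rho * v * gauss rho v))%C
    with (gauss rho v * ((Cexp zeta - 1 - zeta) + - (rho * (z * z))))%C by (unfold zeta; ring).
  rewrite Cmod_mult.
  pose proof (Cmod_ge_0 z). pose proof (Cmod_ge_0 rho). pose proof (Cmod_ge_0 v).
  assert (Hb : 0 <= b) by (apply Rmult_le_pos; lra).
  assert (Hzeta : Cmod zeta <= Cmod z * b).
  { unfold zeta, Cminus. eapply Rle_trans; [apply Cmod_triangle|].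
    rewrite Cmod_opp, !Cmod_mult, Cmod_R, (Rabs_pos_eq 2) by lra.
    assert (Cmod rho * (Cmod z * Cmod z) <= Cmod rho * (Cmod z * 1)).
    { apply Rmult_le_compat_l; auto. apply Rmult_le_compat_l; lra. }
    unfold b; lra. }
  pose proof (Cmod_ge_0 zeta).
  assert (Hzb : Cmod z * b <= b) by nra.
  assert (Hm : Cmod ((Cexp zeta - 1 - zeta) + - (rho * (z * z)))%C
     <= (40 + Cmod rho) * Cmod z ^ 2 * exp (2 * b)).
  { eapply Rle_trans; [apply Cmod_triangle|].
    rewrite Cmod_opp, !Cmod_mult.
    pose proof (Cexp_taylor zeta) as T.
    assert (E1 : exp (Cmod zeta) <= exp b) by (apply exp_le_compat; lra).
    assert (E2 : Cmod zeta ^ 2 <= Cmod z ^ 2 * b ^ 2).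
    { rewrite <- Rpow_mult_distr. apply pow_incr; lra. }
    assert (E3 : b ^ 2 <= 4 * exp b).
    { pose proof (one_plus_sqr_le b) as H3. rewrite (Rabs_pos_eq b) in H3; lra. }
    replace (exp (2 * b)) with (exp b * exp b) by (rewrite <- exp_plus; f_equal; ring).
    pose proof (exp_ineq1_le b). pose proof (pow2_ge_0 (Cmod z)).
    assert (Cmod zeta ^ 2 * exp (Cmod zeta) <= (Cmod z ^ 2 * (4 * exp b)) * exp b).
    { apply Rmult_le_compat; auto; [apply pow2_ge_0|left; apply exp_pos|].
      apply Rle_trans with (1 := E2). now apply Rmult_le_compat_l. }
    assert (1 <= exp b * exp b) by nra.
    assert (Cmod rho * Cmod z ^ 2 * 1 <= Cmod rho * Cmod z ^ 2 * (exp b * exp b)).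
    { apply Rmult_le_compat_l; auto. apply Rmult_le_pos; auto. }
    assert (0 <= Cmod z ^ 2 * (exp b * exp b)) by (apply Rmult_le_pos; lra).
    nra. }
  pose proof (Cmod_ge_0 (gauss rho v)). 
  apply Rle_trans with (Cmod (gauss rho v) * ((40 + Cmod rho) * Cmod z ^ 2 * exp (2 * b))).
  - now apply Rmult_le_compat_l.
  - right; ring.
Qed.

(** The shift [c] is complex, although the integral is over the real line: this is the
    entire extension of the convolution with a Gaussian. *)
Definition gauss_convolution (rho : C) (h : R -> R) (c : C) : C :=
  @RInt_gen C_R_CompleteNormedModule (fun x => gauss rho (RtoC x - c) * RtoC (h x))%C
    (Rbar_locally m_infty) (Rbar_locally p_infty).

Notation is_Cline_int f l := (@is_RInt_gen C_R_NormedModule f (Rbar_locally m_infty) (Rbar_locally p_infty) l).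

Lemma is_RCderive_shift (c : C) (x : R) : is_RCderive (fun x => RtoC x - c)%C x (RtoC 1).
Proof.
  apply is_RCderive_iff; split.
  - apply (is_derive_ext (fun y => y - Re c)); [intros; reflexivity|].
    simpl. auto_derive; auto.
  - apply (is_derive_ext (fun y => 0 - Im c)); [intros; reflexivity|].
    simpl. auto_derive; auto.
Qed.

Lemma gauss_shift_is_RCderive rho c x :
  is_RCderive (fun x => gauss rho (RtoC x - c)%C) x
    (- (2 * rho * (x - c)) * gauss rho (x - c))%C.
Proof.
  replace (- (2 * rho * (x - c)) * gauss rho (x - c))%C with
    (RtoC 1 * (- (2 * rho * (x - c)) * gauss rho (x - c)))%C by ring.
  apply (is_RCderive_comp (gauss rho) (fun x => RtoC x - c)%C).
  - apply gauss_is_Cderive.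
  - apply is_RCderive_shift.
Qed.

Lemma product_is_RCderive rho c (h h' : R -> R) x : (forall x, is_derive h x (h' x)) ->
  is_RCderive (fun x => gauss rho (RtoC x - c) * RtoC (h x))%C x
    (- (2 * rho * (x - c)) * gauss rho (x - c) * h x + gauss rho (x - c) * h' x)%C.
Proof.
  intros Hh. apply (is_RCderive_mult (fun x => gauss rho (RtoC x - c)%C) (fun x => RtoC (h x))).
  - apply gauss_shift_is_RCderive.
  - now apply is_RCderive_real.
Qed.

Lemma product_dominated rho c h M :
  0 < Re rho -> (forall x, Rabs (h x) <= M * exp (Rabs x)) ->
  exists K, @dominated C_R_CompleteNormedModule (fun x => gauss rho (RtoC x - c) * RtoC (h x))%C K.
Proof.
  intros Hr Hh. destruct (gauss_dominated rho c 1 Hr) as [K [K0 HK]].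
  exists (M * K); intros x.
  assert (HM : 0 <= M).
  { specialize (Hh 0). rewrite Rabs_R0, exp_0 in Hh. pose proof (Rabs_pos (h 0)); lra. }
  rewrite <- Cmod_norm, Cmod_mult, Cmod_R.
  specialize (HK x). rewrite Rmult_1_l in HK.
  apply Rle_trans with (M * (Cmod (gauss rho (RtoC x - c)%C) * exp (Rabs x))).
  - rewrite <- Rmult_assoc, (Rmult_comm M), Rmult_assoc.
    apply Rmult_le_compat_l; [apply Cmod_ge_0|apply Hh].
  - rewrite (Rmult_assoc M K). now apply Rmult_le_compat_l.
Qed.

Lemma gauss_convolution_correct rho H k c : 0 < Re rho -> even_tower H ->
  is_Cline_int (fun x => gauss rho (RtoC x - c) * RtoC (H k x))%C (gauss_convolution rho (H k) c).
Proof.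
  intros Hr [Hd [Hb _]]. destruct (Hb k) as [M HM].
  destruct (product_dominated rho c _ _ Hr HM) as [K HK].
  destruct (ex_line_int_dominated _ _ HK) as [l Hl].
  - intros x. eapply is_RCderive_continuous. apply product_is_RCderive. intros; apply Hd.
  - unfold gauss_convolution. replace (RInt_gen _ _ _) with l; [exact Hl|].
    symmetry. now apply is_RInt_gen_unique.
Qed.

(** The integrand is the derivative of gauss (x - c) H k x, which vanishes at both
    ends. *)
Lemma integration_by_parts rho H k c : 0 < Re rho -> even_tower H ->
  is_Cline_int (fun x => - (2 * rho * (x - c)) * gauss rho (x - c) * H k x
    + gauss rho (x - c) * H (S k) x)%C (RtoC 0).
Proof.
  intros Hr [Hd [Hb _]]. destruct (Hb k) as [M HM].
  destruct (product_dominated rho c _ _ Hr HM) as [K HK].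
  replace (RtoC 0) with (@minus C_R_CompleteNormedModule zero zero).
  2: { apply (minus_zero_r (zero : C_R_NormedModule)). }
  apply (is_line_int_antiderivative (V := C_R_CompleteNormedModule)
    (fun x => gauss rho (RtoC x - c) * RtoC (H k x))%C).
  - intros x. apply product_is_RCderive. intros; apply Hd.
  - intros x. apply (continuous_plus (V := C_R_NormedModule)).
    + eapply (is_RCderive_continuous (fun x => - (2 * rho * (x - c)) * gauss rho (x - c) * H k x)%C).
      apply (is_RCderive_mult (fun x => - (2 * rho * (x - c)) * gauss rho (x - c))%C (fun x => RtoC (H k x))).
      * apply (is_RCderive_comp (fun z => - (2 * rho * z) * gauss rho z)%C (fun x => RtoC x - c)%C).
        -- apply (is_Cderive_mult (fun z => - (2 * rho * z))%C (gauss rho)); [|apply gauss_is_Cderive].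
           apply (is_Cderive_ext (fun z => - (2 * rho) * z + 0)%C); [intros; ring|].
           apply is_Cderive_affine.
        -- apply is_RCderive_shift.
      * apply is_RCderive_real, Hd.
    + eapply (is_RCderive_continuous (fun x => gauss rho (x - c) * H (S k) x)%C).
      apply product_is_RCderive. intros; apply Hd.
  - now apply (dominated_vanishes_m _ K).
  - now apply (dominated_vanishes_p _ K).
Qed.

Lemma is_Cline_int_scal (f : R -> C) (l z : C) :
  is_Cline_int f l -> is_Cline_int (fun x => z * f x)%C (z * l)%C.
Proof.
  intros Hl P HP.
  assert (HP' : locally (l : C_R_NormedModule) (fun y => P (z * y)%C)).
  { pose proof (filterdiff_continuous (U := C_R_NormedModule) (V := C_R_NormedModule)
      (fun y => z * y)%C l) as Hc.
    apply Hc; auto. exists (fun y => z * y)%C. apply filterdiff_linear, is_linear_Cmult. }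
  generalize (Hl _ HP'). unfold filtermapi. apply filter_imp. intros [a b] [y [Hy Py]].
  simpl in Hy. exists (z * y)%C; split; auto. simpl.
  pose proof (is_RInt_fct_extend_fst f a b y Hy) as H1.
  pose proof (is_RInt_fct_extend_snd f a b y Hy) as H2.
  destruct z as [z1 z2], y as [y1 y2]; simpl in H1, H2.
  apply is_RInt_fct_extend_pair; simpl.
  - apply (is_RInt_minus (fun x => z1 * fst (f x)) (fun x => z2 * snd (f x)) a b (z1 * y1) (z2 * y2)).
    + apply (is_RInt_scal (fun x => fst (f x)) a b z1 y1 H1).
    + apply (is_RInt_scal (fun x => snd (f x)) a b z2 y2 H2).
  - apply (is_RInt_plus (fun x => z1 * snd (f x)) (fun x => z2 * fst (f x)) a b (z1 * y2) (z2 * y1)).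
    + apply (is_RInt_scal (fun x => snd (f x)) a b z1 y2 H2).
    + apply (is_RInt_scal (fun x => fst (f x)) a b z2 y1 H1).
Qed.

Lemma is_Cline_int_ext (f g : R -> C) (l : C) :
  (forall x, f x = g x) -> is_Cline_int f l -> is_Cline_int g l.
Proof.
  intros E. apply (is_RInt_gen_ext (V := C_R_NormedModule)).
  apply filter_forall; intros ab x _; apply E.
Qed.

(** Integrating by parts, the derivative of the kernel in [c] is moved to [H k].
    Adding [z] times the vanishing integral of [integration_by_parts] makes the
    increment minus its linear part the integral of the Taylor remainder of the
    kernel times [H k], which is quadratic in [z]. *)
Lemma gauss_convolution_is_Cderive rho H k c : 0 < Re rho -> even_tower H ->
  is_Cderive (gauss_convolution rho (H k)) c (gauss_convolution rho (H (S k)) c).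
Proof.
  intros Hr HT. pose proof HT as [_ [Hb _]]. destruct (Hb k) as [M HM].
  assert (HM0 : 0 <= M).
  { specialize (HM 0). rewrite Rabs_R0, exp_0 in HM. pose proof (Rabs_pos (H k 0)); lra. }
  set (A := Cmod rho * 2).
  set (B := Cmod rho * (2 * Cmod c + 1)).
  destruct (gauss_dominated rho c (2 * A + 1) Hr) as [K [K0 HK]].
  apply (is_Cderive_quadratic _ _ _ ((40 + Cmod rho) * (exp (2 * B) * M) * K * PI)).
  intros z Hz.
  assert (Hint : is_Cline_int (fun x =>
    (gauss rho ((x - c) - z) - gauss rho (x - c) - z * (2 * rho * (x - c) * gauss rho (x - c))) * H k x)%C
    (gauss_convolution rho (H k) (c + z) - gauss_convolution rho (H k) c - z * gauss_convolution rho (H (S k)) c)%C).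
  { pose proof (gauss_convolution_correct rho H k (c + z) Hr HT) as I1.
    pose proof (gauss_convolution_correct rho H k c Hr HT) as I2.
    pose proof (gauss_convolution_correct rho H (S k) c Hr HT) as I3.
    pose proof (integration_by_parts rho H k c Hr HT) as I4.
    apply (is_Cline_int_scal _ _ (- z)) in I3. apply (is_Cline_int_scal _ _ z) in I4.
    pose proof (is_RInt_gen_plus _ _ _ _ (is_RInt_gen_minus _ _ _ _ I1 I2)
      (is_RInt_gen_plus _ _ _ _ I3 I4)) as I.
    replace (gauss_convolution rho (H k) (c + z) - gauss_convolution rho (H k) c - z * gauss_convolution rho (H (S k)) c)%C
      with ((gauss_convolution rho (H k) (c + z) - gauss_convolution rho (H k) c) +
            (- z * gauss_convolution rho (H (S k)) c + z * 0))%C by ring.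
    revert I. apply is_Cline_int_ext. intros x.
    replace ((x - c) - z)%C with (x - (c + z))%C by ring.
    change ((gauss rho (x - (c + z)) * H k x - gauss rho (x - c) * H k x) +
      (- z * (gauss rho (x - c) * H (S k) x) +
       z * (- (2 * rho * (x - c)) * gauss rho (x - c) * H k x + gauss rho (x - c) * H (S k) x))
      = (gauss rho (x - (c + z)) - gauss rho (x - c) - z * (2 * rho * (x - c) * gauss rho (x - c))) * H k x)%C.
    ring. }
  assert (HD : @dominated C_R_CompleteNormedModule (fun x =>
    (gauss rho ((x - c) - z) - gauss rho (x - c) - z * (2 * rho * (x - c) * gauss rho (x - c))) * H k x)%C
    ((40 + Cmod rho) * (exp (2 * B) * M) * K * Cmod z ^ 2)).
  { intros x. rewrite <- Cmod_norm, Cmod_mult, Cmod_R.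
    pose proof (gauss_taylor rho (x - c)%C z Hz) as T.
    set (G := Cmod (gauss rho (x - c)%C)) in *.
    pose proof (Cmod_ge_0 (gauss rho (x - c)%C)) as HG; fold G in HG.
    pose proof (Cmod_ge_0 rho). pose proof (pow2_ge_0 (Cmod z)).
    assert (Hv : Cmod (x - c)%C <= Rabs x + Cmod c).
    { unfold Cminus. eapply Rle_trans; [apply Cmod_triangle|].
      rewrite Cmod_opp, Cmod_R; lra. }
    assert (E : exp (2 * (Cmod rho * (2 * Cmod (x - c)%C + 1))) <= exp (2 * B) * exp (2 * A * Rabs x)).
    { rewrite <- exp_plus. apply exp_le_compat. unfold A, B.
      assert (Cmod rho * Cmod (x - c)%C <= Cmod rho * (Rabs x + Cmod c)) by now apply Rmult_le_compat_l.
      lra. }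
    apply Rle_trans with ((40 + Cmod rho) * Cmod z ^ 2 * (G * (exp (2 * B) * exp (2 * A * Rabs x)))
       * (M * exp (Rabs x))).
    - apply Rmult_le_compat; auto; [apply Cmod_ge_0|apply Rabs_pos|].
      apply Rle_trans with (1 := T).
      apply Rmult_le_compat_l; [apply Rmult_le_pos; lra|]. now apply Rmult_le_compat_l.
    - specialize (HK x). fold G in HK.
      rewrite Rmult_plus_distr_r, Rmult_1_l, exp_plus in HK.
      pose proof (exp_pos (2 * B)).
      replace ((40 + Cmod rho) * Cmod z ^ 2 * (G * (exp (2 * B) * exp (2 * A * Rabs x))) * (M * exp (Rabs x)))
        with ((40 + Cmod rho) * (exp (2 * B) * M) * Cmod z ^ 2 * (G * (exp (2 * A * Rabs x) * exp (Rabs x)))) by ring.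
      replace ((40 + Cmod rho) * (exp (2 * B) * M) * K * Cmod z ^ 2 * / (1 + x ^ 2))
        with ((40 + Cmod rho) * (exp (2 * B) * M) * Cmod z ^ 2 * (K * / (1 + x ^ 2))) by ring.
      apply Rmult_le_compat_l; auto.
      apply Rmult_le_pos; auto. apply Rmult_le_pos; [lra|]. apply Rmult_le_pos; lra. }
  pose proof (norm_line_int_dominated (V := C_R_CompleteNormedModule) _ _ _ HD Hint) as N.
  rewrite <- Cmod_norm in N. apply Rle_trans with (1 := N). right; ring.
Qed.

Lemma gauss_convolution_log_Delta4 rho H c : 0 < Re rho -> even_tower H ->
  gauss_convolution rho (log_Delta4 H 0) c = (16 * gauss_convolution rho (H 2%nat) c - gauss_convolution rho (H 0%nat) c)%C.
Proof.
  intros Hr HT. apply (is_RInt_gen_unique (V := C_R_CompleteNormedModule)).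
  pose proof (is_RInt_gen_minus _ _ _ _
    (is_Cline_int_scal _ _ 16 (gauss_convolution_correct rho H 2 c Hr HT))
    (gauss_convolution_correct rho H 0 c Hr HT)) as I.
  revert I. apply is_Cline_int_ext. intros x.
  change ((16 * (gauss rho (x - c) * H 2%nat x) - gauss rho (x - c) * H 0%nat x)
    = gauss rho (x - c) * RtoC (log_Delta4 H 0 x))%C.
  unfold log_Delta4. rewrite RtoC_minus, RtoC_mult. simpl (0 + 2)%nat. ring.
Qed.

Lemma gauss_convolution_odd rho H : 0 < Re rho -> even_tower H -> gauss_convolution rho (H 1%nat) 0 = 0.
Proof.
  intros Hr HT. destruct (even_tower_parity H HT) as [Hodd _].
  apply (is_line_int_odd (V := C_R_CompleteNormedModule)
    (fun x => gauss rho (RtoC x - 0) * RtoC (H 1%nat x))%C).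
  - intros x. rewrite Hodd, !RtoC_opp.
    change (gauss rho (- x - 0) * - H 1%nat x = - (gauss rho (x - 0) * H 1%nat x))%C.
    replace (gauss rho (- x - 0)) with (gauss rho (x - 0)) by (unfold gauss; f_equal; ring).
    ring.
  - now apply gauss_convolution_correct.
Qed.

(** Completing the square: with w = s - 1/2 and x = ln t,
    s x / 2 - x / 4 - rho x^2 = w^2 / (16 rho) - rho (x - w / (4 rho))^2, and
    w^2 + s - s^2 = 1/4. *)
Lemma Mellin_represents rho psi H s : 0 < Re rho -> even_tower H -> represents psi 0 H ->
  (Cexp ((- s ^ 2 + s) / (16 * rho)) * Mellin (log_gauss rho psi) (s / 2)
   = Cexp (1 / (64 * rho)) * gauss_convolution rho (H 0%nat) (1 / (4 * rho) * (s - 1 / 2)))%C.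
Proof.
  intros Hr HT HR.
  assert (Hrho : rho <> 0).
  { intros E. rewrite E in Hr; simpl in Hr; lra. }
  set (w := (s - 1 / 2)%C).
  set (e := Cexp (w * w / (16 * rho))%C).
  assert (E : Mellin (log_gauss rho psi) (s / 2)%C =
    (e * gauss_convolution rho (H 0%nat) (1 / (4 * rho) * w))%C).
  { unfold Mellin.
    refine (is_RInt_gen_unique (V := C_R_CompleteNormedModule)
      (Fa := at_right 0) (Fb := Rbar_locally p_infty) _ _ _).
    pose proof (is_Cline_int_scal _ _ e (gauss_convolution_correct rho H 0 (1 / (4 * rho) * w) Hr HT)) as I.
    apply (is_RInt_gen_log (V := C_R_CompleteNormedModule)) in I.
    - revert I. apply (is_RInt_gen_ext (V := C_R_NormedModule)).
      assert (H1 : at_right 0 (fun x => 0 < x)) by (exists (mkposreal 1 Rlt_0_1); auto).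
      assert (H2 : Rbar_locally p_infty (fun x => 0 < x)) by (exists 0; auto).
      apply (Filter_prod _ _ _ _ _ H1 H2). intros a b Ha Hb t Ht. simpl in Ht.
      assert (Ht0 : 0 < t).
      { apply Rle_lt_trans with (2 := proj1 Ht). left; now apply Rmin_glb_lt. }
      rewrite scal_C. unfold log_gauss. rewrite (HR t Ht0), Rplus_0_r.
      unfold e, gauss. rewrite RtoC_inv, RtoC_mult, <- Cexp_RtoC by lra.
      set (x := ln t). rewrite RtoC_pow, RtoC_opp, RtoC_div by lra.
      match goal with |- ?a = ?b => change (@eq C a b) end.
      transitivity (/ t * (H 0%nat x) *
        (Cexp (w * w / (16 * rho)) *
         Cexp (- rho * ((x - 1 / (4 * rho) * w) * (x - 1 / (4 * rho) * w)))))%C; [ring|].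
      transitivity (/ t * (H 0%nat x) * (Cexp (s / 2 * x) * (Cexp (- rho * x ^ 2) * Cexp (- (x / 4)))))%C.
      2: { unfold Cdiv. ring. }
      rewrite <- !Cexp_plus. do 2 f_equal. unfold w. field. auto.
    - intros x. eapply is_RCderive_continuous.
      apply (is_RCderive_mult (fun _ => e)).
      + apply (is_derive_const (V := C_R_NormedModule)).
      + apply product_is_RCderive. intros; apply HT. }
  rewrite E. unfold e. rewrite Cmult_assoc, <- Cexp_plus. f_equal. f_equal.
  unfold w. field. auto.
Qed.

(** * Primitives along piecewise C1 paths *)

(** Composition with [clamp] extends a function continuous on [a, b] to a function
    continuous on the line. *)
Definition clamp (a b u : R) : R := Rmax a (Rmin b u).

Lemma clamp_in a b u : a <= b -> a <= clamp a b u <= b.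
Proof.
  intros H; unfold clamp; split; [apply Rmax_l|].
  apply Rmax_lub; auto. apply Rmin_l.
Qed.

Lemma clamp_id a b u : a <= u <= b -> clamp a b u = u.
Proof. intros H; unfold clamp. rewrite Rmin_right, Rmax_right; lra. Qed.

Lemma clamp_lipschitz a b u v : Rabs (clamp a b u - clamp a b v) <= Rabs (u - v).
Proof.
  unfold clamp, Rmax, Rmin.
  repeat destruct (Rle_dec _ _); unfold Rabs; repeat destruct (Rcase_abs _); lra.
Qed.

Lemma continuous_clamped {V : UniformSpace} (a b : R) (f : R -> V) :
  a <= b -> continuous_on (fun u => a <= u <= b) f ->
  forall u, continuous (fun u => f (clamp a b u)) u.
Proof.
  intros Hab Hf u.
  apply (filterlim_comp _ _ _ (clamp a b) f _
    (within (fun u => a <= u <= b) (locally (clamp a b u)))).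
  - intros P [eps HP]. exists eps; intros v Hv.
    apply HP; [|now apply clamp_in].
    apply Rle_lt_trans with (1 := clamp_lipschitz a b v u). exact Hv.
  - apply Hf. now apply clamp_in.
Qed.

Lemma locally_between a b u : a < u < b -> locally u (fun v => a < v < b).
Proof.
  intros [H1 H2]. apply filter_and; [now apply (open_gt a)|now apply (open_lt b)].
Qed.

Lemma equal_of_zero_derivative (f : R -> R) a b : a < b ->
  (forall u, a < u < b -> is_derive f u 0) -> (forall u, continuous f u) -> f a = f b.
Proof.
  intros Hab Hd Hc. destruct (MVT_gen f a b (fun _ => 0)) as [c [_ E]].
  - rewrite Rmin_left, Rmax_right by lra; auto.
  - intros u _. apply continuity_pt_filterlim, Hc.
  - lra.
Qed.

Lemma continuous_of_Cderive (F : C -> C) (g : R -> C) (l : C) (u : R) :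
  is_Cderive F (g u) l -> continuous (g : R -> C_R_NormedModule) u ->
  continuous (fun v => F (g v) : C_R_NormedModule) u.
Proof.
  intros HF Hg.
  assert (Hc : filterlim F (locally (g u : AbsRing_UniformSpace C_AbsRing))
    (locally (F (g u) : AbsRing_UniformSpace C_AbsRing))).
  { apply (ex_derive_continuous (K := C_AbsRing) (V := AbsRing_NormedModule C_AbsRing)).
    now exists l. }
  intros P HP. apply locally_C in HP. apply Hc in HP.
  change (locally (g u : AbsRing_UniformSpace C_AbsRing) (fun z => P (F z))) in HP.
  apply locally_C in HP. apply (Hg _ HP).
Qed.

Lemma continuous_Re (f : R -> C) (u : R) :
  continuous (f : R -> C_R_NormedModule) u -> continuous (fun v => Re (f v)) u.
Proof.
  intros Hf. apply (continuous_comp (f : R -> C_R_NormedModule) Re); auto.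
  destruct (f u); apply continuous_fst.
Qed.

Lemma continuous_Im (f : R -> C) (u : R) :
  continuous (f : R -> C_R_NormedModule) u -> continuous (fun v => Im (f v)) u.
Proof.
  intros Hf. apply (continuous_comp (f : R -> C_R_NormedModule) Im); auto.
  destruct (f u); apply continuous_snd.
Qed.

Lemma continuous_Cmult (f g : R -> C) u :
  continuous (f : R -> C_R_NormedModule) u -> continuous (g : R -> C_R_NormedModule) u ->
  continuous (fun v => f v * g v : C_R_NormedModule)%C u.
Proof.
  intros Hf Hg.
  pose proof (continuous_Re f u Hf); pose proof (continuous_Re g u Hg).
  pose proof (continuous_Im f u Hf); pose proof (continuous_Im g u Hg).
  apply (continuous_comp_2 (V := R_UniformSpace) (W := R_UniformSpace)
    (fun v => Re (f v) * Re (g v) - Im (f v) * Im (g v))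
    (fun v => Re (f v) * Im (g v) + Im (f v) * Re (g v)) (fun x y => (x, y))).
  - apply (continuous_minus (fun v => Re (f v) * Re (g v)));
      apply (continuous_mult (K := R_AbsRing)); auto.
  - apply (continuous_plus (fun v => Re (f v) * Im (g v)));
      apply (continuous_mult (K := R_AbsRing)); auto.
  - apply (continuous_ext (fun x => x)); [intros [x y]; reflexivity|apply continuous_id].
Qed.

(** The difference between F along the path and the indefinite integral of the
    integrand is continuous and has derivative zero inside the interval. *)
Lemma path_piece (F f f' : C -> C) (g dg : R -> C) (a b : R) :
  (forall z, is_Cderive F z (f z)) -> (forall z, is_Cderive f z (f' z)) -> a < b ->
  continuous_on (U := C_R_NormedModule) (fun u => a <= u <= b) g ->
  continuous_on (U := C_R_NormedModule) (fun u => a <= u <= b) dg ->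
  (forall u, a < u < b -> is_RCderive g u (dg u)) ->
  @is_RInt C_R_NormedModule
    (fun u => f (g u) * (Derive (fun v => Re (g v)) u, Derive (fun v => Im (g v)) u))%C
    a b (F (g b) - F (g a))%C.
Proof.
  intros HF Hf Hab Hg Hdg Hd.
  set (gc := fun u => g (clamp a b u)). set (dc := fun u => dg (clamp a b u)).
  assert (Hgc : forall u, continuous (gc : R -> C_R_NormedModule) u)
    by (apply (continuous_clamped (V := C_R_NormedModule)); auto; lra).
  assert (Hdc : forall u, continuous (dc : R -> C_R_NormedModule) u)
    by (apply (continuous_clamped (V := C_R_NormedModule)); auto; lra).
  set (phi := fun u => (f (gc u) * dc u)%C).
  assert (Hphi : forall u, continuous (phi : R -> C_R_NormedModule) u).
  { intros u; apply continuous_Cmult; auto. now apply (continuous_of_Cderive _ _ (f' (gc u))). }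
  set (I := fun u => @RInt C_R_CompleteNormedModule phi a u).
  assert (HI : forall u, @is_RInt C_R_NormedModule phi a u (I u)).
  { intros u. apply (RInt_correct (V := C_R_CompleteNormedModule)).
    apply (ex_RInt_continuous (V := C_R_CompleteNormedModule)); auto. }
  assert (HdI : forall u, is_RCderive I u (phi u)).
  { intros u. apply (is_derive_RInt (V := C_R_NormedModule) phi I a u); auto.
    apply filter_forall; auto. }
  assert (HdF : forall u, a < u < b -> is_RCderive (fun u => F (gc u)) u (phi u)).
  { intros u Hu.
    apply (is_derive_ext_loc (V := C_R_NormedModule) (fun u => F (g u))).
    - generalize (locally_between a b u Hu); apply filter_imp; intros v Hv.
      unfold gc; rewrite clamp_id by lra; reflexivity.
    - replace (phi u) with (dg u * f (g u))%C
        by (unfold phi, gc, dc; rewrite clamp_id by lra; apply Cmult_comm).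
      apply is_RCderive_comp; auto. }
  assert (HcF : forall u, continuous (fun u => F (gc u) : C_R_NormedModule) u).
  { intros u. now apply (continuous_of_Cderive _ _ (f (gc u))). }
  assert (HcI : forall u, continuous (I : R -> C_R_NormedModule) u)
    by (intros u; apply (is_RCderive_continuous I u _ (HdI u))).
  assert (Ia : I a = RtoC 0) by apply (RInt_point (V := C_R_CompleteNormedModule)).
  assert (ERe : Re (F (gc a)) - Re (I a) = Re (F (gc b)) - Re (I b)).
  { apply (equal_of_zero_derivative (fun u => Re (F (gc u)) - Re (I u)) a b Hab).
    - intros u Hu. rewrite <- (Rminus_diag (Re (phi u))).
      apply (is_derive_minus (fun u => Re (F (gc u))) (fun u => Re (I u))).
      + apply (proj1 (is_RCderive_iff _ _ _) (HdF u Hu)).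
      + apply (proj1 (is_RCderive_iff _ _ _) (HdI u)).
    - intros u. apply (continuous_minus (fun u => Re (F (gc u))) (fun u => Re (I u))).
      + apply (continuous_Re (fun u => F (gc u))), HcF.
      + apply continuous_Re, HcI. }
  assert (EIm : Im (F (gc a)) - Im (I a) = Im (F (gc b)) - Im (I b)).
  { apply (equal_of_zero_derivative (fun u => Im (F (gc u)) - Im (I u)) a b Hab).
    - intros u Hu. rewrite <- (Rminus_diag (Im (phi u))).
      apply (is_derive_minus (fun u => Im (F (gc u))) (fun u => Im (I u))).
      + apply (proj1 (is_RCderive_iff _ _ _) (HdF u Hu)).
      + apply (proj1 (is_RCderive_iff _ _ _) (HdI u)).
    - intros u. apply (continuous_minus (fun u => Im (F (gc u))) (fun u => Im (I u))).
      + apply (continuous_Im (fun u => F (gc u))), HcF.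
      + apply continuous_Im, HcI. }
  assert (Eb : (F (g b) - F (g a))%C = I b).
  { rewrite Ia in ERe, EIm. simpl in ERe, EIm. unfold gc in ERe, EIm.
    rewrite !clamp_id in ERe, EIm by lra.
    change (Re (F (g a)) - 0 = Re (F (g b)) - Re (I b)) in ERe.
    change (Im (F (g a)) - 0 = Im (F (g b)) - Im (I b)) in EIm.
    apply injective_projections.
    - change (Re (F (g b)) + - Re (F (g a)) = Re (I b)). lra.
    - change (Im (F (g b)) + - Im (F (g a)) = Im (I b)). lra. }
  rewrite Eb. apply (is_RInt_ext (V := C_R_NormedModule) phi); [|apply HI].
  rewrite Rmin_left, Rmax_right by lra. intros u Hu.
  unfold phi, gc, dc. rewrite clamp_id by lra.
  destruct (proj1 (is_RCderive_iff _ _ _) (Hd u Hu)) as [D1 D2].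
  apply is_derive_unique in D1, D2.
  apply (f_equal (Cmult (f (g u)))).
  apply injective_projections; symmetry; [exact D1|exact D2].
Qed.

(** Differentiability of [f] serves to ensure its continuity. *)
Lemma path_integral_primitive (F f f' : C -> C) (g : R -> C) (z w : C) :
  (forall z, is_Cderive F z (f z)) -> (forall z, is_Cderive f z (f' z)) ->
  piecewise_C1_path g z w -> path_integral f g = (F w - F z)%C.
Proof.
  intros HF Hf [g0 [g1 [gcont [m [u [u0 [um Hu]]]]]]].
  assert (Hmono : forall i j, (i <= j)%nat -> (j <= m)%nat -> u i <= u j).
  { intros i j Hij; induction Hij as [|j Hij IH]; intros Hj; [lra|].
    apply Rle_trans with (u j); [apply IH; lia|]. left; apply Hu; lia. }
  assert (H : forall k, (k <= m)%nat -> @is_RInt C_R_NormedModule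
    (fun u => f (g u) * (Derive (fun v => Re (g v)) u, Derive (fun v => Im (g v)) u))%C
    0 (u k) (F (g (u k)) - F z)%C).
  { induction k as [|k IH]; intros Hk.
    - rewrite u0, g0. replace (F z - F z)%C with (zero : C_R_NormedModule).
      + apply (is_RInt_point (V := C_R_NormedModule)).
      + change (RtoC 0 = F z - F z)%C; ring.
    - destruct (Hu k ltac:(lia)) as [Hlt [dg [dgc Hdg]]].
      replace (F (g (u (S k))) - F z)%C with
        (plus (F (g (u k)) - F z : C_R_NormedModule)%C (F (g (u (S k))) - F (g (u k)))%C).
      2: { change ((F (g (u k)) - F z) + (F (g (u (S k))) - F (g (u k))) = F (g (u (S k))) - F z)%C. ring. }
      apply (is_RInt_Chasles (V := C_R_NormedModule) _ 0 (u k)); [apply IH; lia|].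
      apply (path_piece F f f' g dg); auto.
      (* restriction of the path to one piece *)
      intros v Hv.
      assert (H01 : 0 <= v <= 1).
      { pose proof (Hmono 0%nat k ltac:(lia) ltac:(lia)).
        pose proof (Hmono (S k) m ltac:(lia) ltac:(lia)). lra. }
      apply (filterlim_filter_le_1 (F := within (fun t => 0 <= t <= 1) (locally v)) g).
      + intros P. unfold within. apply filter_imp. intros x HP Hx. apply HP.
        pose proof (Hmono 0%nat k ltac:(lia) ltac:(lia)).
        pose proof (Hmono (S k) m ltac:(lia) ltac:(lia)). lra.
      + now apply gcont. }
  unfold path_integral.
  apply (is_RInt_unique (V := C_R_CompleteNormedModule)).
  specialize (H m (Nat.le_refl m)). rewrite um, g1 in H. exact H.
Qed.

(** * Variation of constants *)

Lemma Csinh_is_Cderive z : is_Cderive Csinh z (Ccosh z).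
Proof.
  eapply is_Cderive_eq.
  - apply (is_Cderive_ext (fun z => / 2 * Cexp z + (- / 2) * Cexp (-1 * z + 0))%C).
    { intros y. unfold Csinh. replace (-1 * y + 0)%C with (- y)%C by ring. field. }
    apply (is_Cderive_plus (fun z => / 2 * Cexp z)%C (fun z => (- / 2) * Cexp (-1 * z + 0))%C).
    + apply (is_Cderive_mult (fun _ => / 2)%C Cexp); [apply is_Cderive_const|apply Cexp_is_Cderive].
    + apply (is_Cderive_mult (fun _ => - / 2)%C (fun z => Cexp (-1 * z + 0))%C); [apply is_Cderive_const|].
      apply (is_Cderive_comp Cexp (fun z => -1 * z + 0)%C); [apply Cexp_is_Cderive|apply is_Cderive_affine].
  - unfold Ccosh. replace (-1 * z + 0)%C with (- z)%C by ring. field.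
Qed.

Lemma Ccosh_is_Cderive z : is_Cderive Ccosh z (Csinh z).
Proof.
  eapply is_Cderive_eq.
  - apply (is_Cderive_ext (fun z => / 2 * Cexp z + / 2 * Cexp (-1 * z + 0))%C).
    { intros y. unfold Ccosh. replace (-1 * y + 0)%C with (- y)%C by ring. field. }
    apply (is_Cderive_plus (fun z => / 2 * Cexp z)%C (fun z => / 2 * Cexp (-1 * z + 0))%C).
    + apply (is_Cderive_mult (fun _ => / 2)%C Cexp); [apply is_Cderive_const|apply Cexp_is_Cderive].
    + apply (is_Cderive_mult (fun _ => / 2)%C (fun z => Cexp (-1 * z + 0))%C); [apply is_Cderive_const|].
      apply (is_Cderive_comp Cexp (fun z => -1 * z + 0)%C); [apply Cexp_is_Cderive|apply is_Cderive_affine].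
  - unfold Csinh. replace (-1 * z + 0)%C with (- z)%C by ring. field.
Qed.

Lemma Csinh_0 : Csinh 0 = 0.
Proof. unfold Csinh. replace (- 0)%C with (RtoC 0) by ring. field. Qed.

Lemma Ccosh_0 : Ccosh 0 = 1.
Proof.
  unfold Ccosh. replace (- 0)%C with (RtoC 0) by ring. rewrite Cexp_RtoC, exp_0. field.
Qed.

Lemma Ccosh_opp z : Ccosh (- z) = Ccosh z.
Proof. unfold Ccosh. replace (- - z)%C with z by ring. field. Qed.

Lemma path_integral_ext f1 f2 g : (forall z, f1 z = f2 z) -> path_integral f1 g = path_integral f2 g.
Proof.
  intros E. unfold path_integral. apply (RInt_ext (V := C_R_CompleteNormedModule)).
  intros u _. now rewrite E.
Qed.

(** [J i t] below is the convolution of [H i] as a function of the original variable, so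
    its derivative is 4 k J (i + 1), and [F] is the primitive of the integrand given
    by the method of variation of constants.  At t = 1/2 the term with sinh drops out
    because [H 1] is odd. *)
Lemma variation_of_constants rho H (e s : C) g :
  0 < Re rho -> even_tower H -> piecewise_C1_path g (1 / 2)%C s ->
  (e * gauss_convolution rho (H 0%nat) (1 / (4 * rho) * (s - 1 / 2))
   = e * gauss_convolution rho (H 0%nat) 0 * Ccosh ((1 / 2 - s) / (16 * rho))
     + 1 / (16 * rho) * path_integral (fun t => Csinh ((s - t) / (16 * rho)) *
         (e * gauss_convolution rho (log_Delta4 H 0) (1 / (4 * rho) * (t - 1 / 2)))) g)%C.
Proof.
  intros Hr HT Hg.
  assert (Hrho : rho <> 0).
  { intros E. rewrite E in Hr; simpl in Hr; lra. }
  set (k := (1 / (16 * rho))%C).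
  assert (Hk : k <> 0).
  { unfold k. intros E. apply C1_nz. transitivity (k * (16 * rho))%C; [unfold k; field; auto|].
    unfold k; rewrite E; ring. }
  set (J := fun i t => gauss_convolution rho (H i) (4 * k * t + - (2 * k))%C).
  set (sh := fun t => Csinh (- k * t + k * s)%C).
  set (ch := fun t => Ccosh (- k * t + k * s)%C).
  assert (DJ : forall i t, is_Cderive (J i) t (4 * k * J (S i) t)%C).
  { intros i t. apply (is_Cderive_comp (gauss_convolution rho (H i)) (fun t => 4 * k * t + - (2 * k))%C).
    - now apply gauss_convolution_is_Cderive.
    - apply is_Cderive_affine. }
  assert (Dsh : forall t, is_Cderive sh t (- k * ch t)%C).
  { intros t. apply (is_Cderive_comp Csinh (fun t => - k * t + k * s)%C).
    - apply Csinh_is_Cderive.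
    - apply is_Cderive_affine. }
  assert (Dch : forall t, is_Cderive ch t (- k * sh t)%C).
  { intros t. apply (is_Cderive_comp Ccosh (fun t => - k * t + k * s)%C).
    - apply Ccosh_is_Cderive.
    - apply is_Cderive_affine. }
  set (f := fun t => (e * sh t * (16 * J 2%nat t + (-1) * J 0%nat t))%C).
  set (f' := fun t => ((0 * sh t + e * (- k * ch t)) * (16 * J 2%nat t + (-1) * J 0%nat t) +
     e * sh t * ((0 * J 2%nat t + 16 * (4 * k * J 3%nat t)) + (0 * J 0%nat t + (-1) * (4 * k * J 1%nat t))))%C).
  set (F := fun t => (e * / k * (4 * (sh t * J 1%nat t) + ch t * J 0%nat t))%C).
  assert (E : path_integral f g = (F s - F (1 / 2))%C).
  { apply (path_integral_primitive F f f'); auto.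
    - intros t. eapply is_Cderive_eq.
      + apply (is_Cderive_mult (fun _ => e * / k)%C (fun t => 4 * (sh t * J 1%nat t) + ch t * J 0%nat t)%C).
        { apply is_Cderive_const. }
        apply (is_Cderive_plus (fun t => 4 * (sh t * J 1%nat t))%C (fun t => ch t * J 0%nat t)%C).
        * apply (is_Cderive_mult (fun _ => RtoC 4) (fun t => sh t * J 1%nat t)%C); [apply is_Cderive_const|].
          apply (is_Cderive_mult sh (J 1%nat)); auto.
        * apply (is_Cderive_mult ch (J 0%nat)); auto.
      + unfold f. field. auto.
    - intros t. unfold f'.
      apply (is_Cderive_mult (fun t => e * sh t)%C (fun t => 16 * J 2%nat t + (-1) * J 0%nat t)%C).
      { apply (is_Cderive_mult (fun _ => e) sh); [apply is_Cderive_const|auto]. }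
      apply (is_Cderive_plus (fun t => 16 * J 2%nat t)%C (fun t => (-1) * J 0%nat t)%C).
      + apply (is_Cderive_mult (fun _ => RtoC 16) (J 2%nat)); [apply is_Cderive_const|auto].
      + apply (is_Cderive_mult (fun _ => RtoC (-1)) (J 0%nat)); [apply is_Cderive_const|auto]. }
  assert (Earg : forall t, (1 / (4 * rho) * (t - 1 / 2) = 4 * k * t + - (2 * k))%C).
  { intros t; unfold k; field; auto. }
  rewrite (path_integral_ext _ f).
  2: { intros t. rewrite Earg, gauss_convolution_log_Delta4 by auto. unfold f, sh, J.
       replace ((s - t) / (16 * rho))%C with (- k * t + k * s)%C by (unfold k; field; auto).
       ring. }
  rewrite E, Earg. unfold F, sh, ch.
  replace (- k * s + k * s)%C with (RtoC 0) by ring.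
  replace (- k * (1 / 2) + k * s)%C with (- ((1 / 2 - s) / (16 * rho)))%C by (unfold k; field; auto).
  rewrite Ccosh_opp.
  unfold J. replace (4 * k * (1 / 2) + - (2 * k))%C with (RtoC 0) by field.
  rewrite Csinh_0, Ccosh_0, gauss_convolution_odd by auto.
  field. auto.
Qed.

Theorem mainTheorem3 :
  forall (rho : C) (n : nat), 0 < Re rho ->
  forall (s : C) (g : R -> C), piecewise_C1_path g (1 / 2)%C s ->
  (Cexp ((- s ^ 2 + s) / (16 * rho))
     * Mellin (log_gauss rho (Nat.iter (n + 1) Delta4 Psi)) (s / 2)
   = Cexp (1 / (64 * rho))
       * Mellin (log_gauss rho (Nat.iter (n + 1) Delta4 Psi)) (1 / 4)
       * Ccosh ((1 / 2 - s) / (16 * rho))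
     + 1 / (16 * rho)
       * path_integral
           (fun t => Csinh ((s - t) / (16 * rho))
                     * Cexp ((- t ^ 2 + t) / (16 * rho))
                     * Mellin (log_gauss rho (Nat.iter (n + 2) Delta4 Psi)) (t / 2))
           g)%C.
Proof.
  intros rho n Hr s g Hg.
  assert (Hrho : rho <> 0).
  { intros E. rewrite E in Hr; simpl in Hr; lra. }
  destruct (iter_Delta4_represents Psi _ theta_tower n theta_even_tower Psi_represented)
    as [HT HR].
  set (H := Nat.iter (n + 1) log_Delta4 theta_tower) in *.
  set (psi := Nat.iter (n + 1) Delta4 Psi) in *.
  assert (E2 : Nat.iter (n + 2) Delta4 Psi = Delta4 psi).
  { unfold psi. replace (n + 2)%nat with (S (n + 1)) by lia. reflexivity. }
  rewrite E2.
  pose proof (Delta4_represents psi 0 H HT HR) as HR2.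
  pose proof (even_tower_log_Delta4 H HT) as HT2.
  set (e := Cexp (1 / (64 * rho))%C).
  rewrite (Mellin_represents rho psi H s Hr HT HR). fold e.
  assert (Ehalf : (e * Mellin (log_gauss rho psi) (1 / 4) = e * gauss_convolution rho (H 0%nat) 0)%C).
  { pose proof (Mellin_represents rho psi H (1 / 2)%C Hr HT HR) as M.
    replace (1 / 2 / 2)%C with (1 / 4)%C in M by field.
    replace ((- (1 / 2) ^ 2 + 1 / 2) / (16 * rho))%C with (1 / (64 * rho))%C in M by (field; auto).
    replace (1 / (4 * rho) * (1 / 2 - 1 / 2))%C with (RtoC 0) in M by (field; auto).
    exact M. }
  rewrite Ehalf, (variation_of_constants rho H e s g Hr HT Hg).
  do 2 f_equal. apply path_integral_ext; intros t.
  rewrite <- Cmult_assoc, (Mellin_represents rho _ _ t Hr HT2 HR2). reflexivity.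
Qed.
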